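(* Assume (C1) and (C2). Then problem (P) has a sign-changing solution $u_0\in\mathcal{M}$ (that is, $u_0$ is a critical point of $I$ on $\mathcal{D}$ with $u_0^+\neq 0$ and $u_0^-\neq 0$) such that $$I(u_0)=\inf_{u\in\mathcal{M}}I(u)=:m_*>0,$$ and $u_0$ changes sign only once.
   Context: Fix real numbers $p,q,r$ with $1<p<q$, $\frac{p}{2}$ a positive integer, and $r\ge 1$, and functions $a,b,c:\mathbb{Z}\to(0,+\infty)$. Conditions: - (C1) There is $b_0>0$ with $b(n)\ge b_0$ for all $n\in\mathbb{Z}$ and $\lim_{|n|\to\infty}b(n)=+\infty$. - (C2) There is $c_0>0$ with $c(n)\le c_0$ for all $n\in\mathbb{Z}$ and $\sum_{n\in\mathbb{Z}}c(n)<+\infty$. Notation for a real sequence $u=(u(n))_{n\in\mathbb{Z}}$: $\Delta u(n)=u(n+1)-u(n)$, $u^+(n)=\max\{u(n),0\}$, $u^-(n)=\min\{u(n),0\}$, and $\varphi_p(s)=|s|^{p-2}s$. Spaces: - $E$ is the set of real sequences $u$ with $\|u\|:=\big(\sum_{n\in\mathbb{Z}}[a(n)|\Delta u(n)|^p+b(n)|u(n)|^p]\big)^{1/p}<\infty$. - $\mathcal{D}=\{u\in E:\sum_{n\in\mathbb{Z}}c(n)|u(n)|^q\ln|u(n)|^r<+\infty\}$, where terms with $u(n)=0$ are read as $0$. It carries the norm $\|\cdot\|$. For $u,v\in\mathcal{D}$: - $I(u)=\frac1p\|u\|^p+\frac{r}{q^2}\sum_{n}c(n)|u(n)|^q-\frac1q\sum_{n}c(n)|u(n)|^q\ln|u(n)|^r$.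 - $\langle I'(u),v\rangle=\sum_n\big[a(n)|\Delta u(n)|^{p-2}\Delta u(n)\Delta v(n)+b(n)|u(n)|^{p-2}u(n)v(n)\big]-\sum_n c(n)|u(n)|^{q-2}u(n)v(n)\ln|u(n)|^r$. Sets: - $\mathcal{N}=\{u\in\mathcal{D}:u\neq0,\ \langle I'(u),u\rangle=0\}$. - $\mathcal{M}=\{u\in\mathcal{D}:u^+\ne0,\ u^-\neq0,\ \langle I'(u),u^+\rangle=0,\ \langle I'(u),u^-\rangle=0\}$. Problem (P) is $$-\Delta\big(a(n-1)\varphi_p(\Delta u(n-1))\big)+b(n)\varphi_p(u(n))=c(n)|u(n)|^{q-2}u(n)\ln|u(n)|^r,\quad n\in\mathbb{Z},$$ together with $\lim_{|n|\to\infty}u(n)=0$. A solution of (P) means a critical point of $I$ in $\mathcal{D}$, i.e. $u\in\mathcal{D}$ with $\langle I'(u),v\rangle=0$ for all $v\in\mathcal{D}$. *)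

(* Defs.v *)
From Stdlib Require Import Reals ZArith.
From Coquelicot Require Import Coquelicot.
Open Scope R_scope.

(* |x|^y for x >= 0 and real y > 0, with the convention 0^y = 0. *)
Definition rpow (x y : R) : R := if Req_EM_T x 0 then 0 else Rpower x y.

Definition zpair (f : Z -> R) (k : nat) : R :=
  match k with
  | O => f 0%Z
  | S m => f (Z.of_nat (S m)) + f (- Z.of_nat (S m))%Z
  end.

Definition zsummable (f : Z -> R) : Prop := ex_series (zpair (fun n => Rabs (f n))).

(* Sum over Z (meaningful for summable families). *)
Definition zsum (f : Z -> R) : R := Series (zpair f).

Definition Delta (u : Z -> R) (n : Z) : R := u (n + 1)%Z - u n.
Definition posp (u : Z -> R) (n : Z) : R := Rmax (u n) 0.
Definition negp (u : Z -> R) (n : Z) : R := Rmin (u n) 0.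
Definition phi (p s : R) : R := rpow (Rabs s) (p - 2) * s.

Section Setting.
Variables (p q r : R) (a b c : Z -> R).

Definition normterm (u : Z -> R) (n : Z) : R :=
  a n * rpow (Rabs (Delta u n)) p + b n * rpow (Rabs (u n)) p.

Definition normp (u : Z -> R) : R := zsum (normterm u).

Definition inE (u : Z -> R) : Prop := zsummable (normterm u).

Definition logterm (u : Z -> R) (n : Z) : R :=
  if Req_EM_T (u n) 0 then 0
  else c n * rpow (Rabs (u n)) q * ln (rpow (Rabs (u n)) r).

(* D: u in E and sum_n c|u|^q ln|u|^r < +oo (its positive part is summable;
   the negative part is automatically summable for u in E). *)
Definition inD (u : Z -> R) : Prop :=
  inE u /\ zsummable (fun n => Rmax 0 (logterm u n)).

Definition I (u : Z -> R) : R :=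
  1 / p * normp u
  + r / (q ^ 2) * zsum (fun n => c n * rpow (Rabs (u n)) q)
  - 1 / q * zsum (logterm u).

Definition dI (u v : Z -> R) : R :=
  zsum (fun n => a n * rpow (Rabs (Delta u n)) (p - 2) * Delta u n * Delta v n
               + b n * rpow (Rabs (u n)) (p - 2) * u n * v n)
  - zsum (fun n => if Req_EM_T (u n) 0 then 0
                   else c n * rpow (Rabs (u n)) (q - 2) * u n * v n
                        * ln (rpow (Rabs (u n)) r)).

Definition inN (u : Z -> R) : Prop :=
  inD u /\ u <> (fun _ => 0) /\ dI u u = 0.

Definition inM (u : Z -> R) : Prop :=
  inD u /\ posp u <> (fun _ => 0) /\ negp u <> (fun _ => 0)
  /\ dI u (posp u) = 0 /\ dI u (negp u) = 0.

Definition critical (u : Z -> R) : Prop :=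
  inD u /\ forall v, inD v -> dI u v = 0.
End Setting.

(* u changes sign only once: the signs of its nonzero entries (in the order of Z)
   switch exactly once, i.e. there is a cut k with u >= 0 on (-oo,k], u <= 0 on
   (k,+oo), or the reverse, and u takes both strict signs. *)
Definition changes_sign_once (u : Z -> R) : Prop :=
  (exists n, u n > 0) /\ (exists n, u n < 0) /\
  exists k : Z,
    (forall n, (n <= k)%Z -> 0 <= u n) /\ (forall n, (k < n)%Z -> u n <= 0)
    \/ (forall n, (n <= k)%Z -> u n <= 0) /\ (forall n, (k < n)%Z -> 0 <= u n).

(* Main.v *)
(** On a fiber [s u^+ + t u^-], [s, t >= 0], the energy satisfies
    [I(u) >= I(s u^+ + t u^-) + (1 - s^q)/q <I'(u), u^+> + (1 - t^q)/q <I'(u), u^->]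
    with a strictly positive defect unless [s = t = 1] (if [u^+, u^- <> 0]): the differences [Delta u^+] and
    [Delta u^-] always have the same sign, so the norm part follows from convexity, and the
    logarithmic part from [x - 1 <= x ln x]. So a point of [M] is the strict maximum of its
    fiber, and conversely an interior local maximum of a fiber lies in [M].

    Minimality.  The logarithmic sums are dominated by multiples of [c], hence pass to
    coordinatewise limits along bounded sequences; with Fatou's lemma for the norm, the
    projection on [M] of the limit of a minimizing sequence is a minimizer [w].

    Criticality.  If [<I'(w), delta_n> <> 0], a small change of [w n] lowers [I] on the whole
    part of the fiber near [(1, 1)], while the fiber keeps an interior maximum there, that is,
    a point of [M] below the minimum.

    One sign change.  If the signs of [w] showed a pattern [+ - +] or [- + -], delete the
    last sign component [z].  Then [v = w - z] has [<I'(v), v^+> <= 0] and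
    [<I'(v), v^-> <= 0], so the whole fiber of [v] lies below
    [I(v) - <I'(v), v>/q < I(w) - <I'(w), w>/q = I(w)]. *)

From Stdlib Require Import Reals ZArith Lra Lia Classical ClassicalChoice
  FunctionalExtensionality.
From Coquelicot Require Import Coquelicot.
(* Imported last: [Stdlib.Reals] also defines a [Delta]. *)
Require Import Defs.
Open Scope R_scope.

(** * Sums over the integers *)

(** Differentiation takes place only in one real variable. Along a fiber the norm is replaced by its
    tangent plane, which lies below it; off the fiber a single entry of the sequence is moved. The
    weight (1 - s^q)/q carries the homogeneity of sum c|u|^q: with it the terms in sum c|u|^q ln|u|
    cancel exactly, and only the norm costs an inequality. For the same reason I(u) - <I'(u), u>/q =
    (1/p - 1/q) ||u||^p + (r/q^2) sum c|u|^q contains no logarithm; this bounds minimizing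
    sequences, makes the minimum positive and gives the strict inequality behind the single sign
    change. The danger in the limit is that u^+ or u^- vanishes. On M the pairing of the norm with
    u^+ equals r sum c|u^+|^q ln|u^+|, so this sum is positive, some entry of u^+ exceeds 1, and the
    pairing is at least b0. This bound survives coordinatewise limits. Differences couple
    neighbouring sites, hence u^+ with u^-. The coupling is harmless because pieces obtained by
    monotone maps, or by cutting a sign part where it vanishes, have increments of the same sign. *)

Lemma zpair_ext (f g : Z -> R) :
  (forall n, f n = g n) -> forall k, zpair f k = zpair g k.
Proof. intros H [|k]; simpl; rewrite !H; reflexivity. Qed.

Lemma zpair_le (f g : Z -> R) :
  (forall n, f n <= g n) -> forall k, zpair f k <= zpair g k.
Proof.
  intros H [|k]; simpl; [apply H | apply Rplus_le_compat; apply H].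
Qed.

Lemma zpair_plus (f g : Z -> R) k :
  zpair (fun n => f n + g n) k = zpair f k + zpair g k.
Proof. destruct k; simpl; ring. Qed.

Lemma zpair_scal x (f : Z -> R) k : zpair (fun n => x * f n) k = x * zpair f k.
Proof. destruct k; simpl; ring. Qed.

Lemma zpair_abs (f : Z -> R) k : Rabs (zpair f k) <= zpair (fun n => Rabs (f n)) k.
Proof. destruct k; simpl; [lra | apply Rabs_triang]. Qed.

Lemma zpair_ge0 (f : Z -> R) : (forall n, 0 <= f n) -> forall k, 0 <= zpair f k.
Proof.
  intros H k; replace 0 with (zpair (fun _ => 0) k) by (destruct k; simpl; ring).
  now apply zpair_le.
Qed.

Lemma zpair_ge_term (f : Z -> R) (n : Z) :
  (forall m, 0 <= f m) -> f n <= zpair f (Z.abs_nat n).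
Proof.
  intros H; destruct (Z.abs_nat n) as [|k] eqn:E; simpl.
  - replace n with 0%Z by lia; lra.
  - destruct (Z_le_gt_dec 0 n).
    + replace (Z.pos (Pos.of_succ_nat k)) with n by lia.
      generalize (H (- n)%Z); replace (Z.neg (Pos.of_succ_nat k)) with (- n)%Z by lia; lra.
    + replace (Z.neg (Pos.of_succ_nat k)) with n by lia.
      generalize (H (Z.pos (Pos.of_succ_nat k))); lra.
Qed.

Lemma zsummable_ex (f : Z -> R) : zsummable f -> ex_series (zpair f).
Proof.
  intros H; apply (ex_series_le (zpair f) (zpair (fun n => Rabs (f n)))); [|exact H].
  intros k; apply zpair_abs.
Qed.

Lemma zsummable_le (f g : Z -> R) :
  (forall n, Rabs (f n) <= g n) -> zsummable g -> zsummable f.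
Proof.
  intros H Hg.
  apply (ex_series_le (zpair (fun n => Rabs (f n))) (zpair (fun n => Rabs (g n))));
    [|exact Hg].
  intros k; change (norm (zpair (fun n => Rabs (f n)) k))
    with (Rabs (zpair (fun n => Rabs (f n)) k)).
  rewrite Rabs_pos_eq by (apply zpair_ge0; intros; apply Rabs_pos).
  apply zpair_le; intros n; eapply Rle_trans; [apply H | apply Rle_abs].
Qed.

Lemma zsummable_ext (f g : Z -> R) :
  (forall n, f n = g n) -> zsummable f -> zsummable g.
Proof.
  intros H; apply ex_series_ext, zpair_ext; intros n; now rewrite H.
Qed.

Lemma zsummable_plus (f g : Z -> R) :
  zsummable f -> zsummable g -> zsummable (fun n => f n + g n).
Proof.
  intros Hf Hg; apply (zsummable_le _ (fun n => Rabs (f n) + Rabs (g n))).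
  - intros; apply Rabs_triang.
  - assert (H := ex_series_plus _ _ Hf Hg); revert H; apply ex_series_ext.
    intros k; change (@plus _) with Rplus; simpl; rewrite <- zpair_plus.
    apply zpair_ext; intros n.
    rewrite (Rabs_pos_eq (_ + _)); [reflexivity|].
    generalize (Rabs_pos (f n)) (Rabs_pos (g n)); lra.
Qed.

Lemma zsummable_scal x (f : Z -> R) : zsummable f -> zsummable (fun n => x * f n).
Proof.
  intros Hf; assert (H := ex_series_scal_l (Rabs x) _ Hf); revert H; apply ex_series_ext.
  intros k; rewrite <- zpair_scal; apply zpair_ext; intros; now rewrite Rabs_mult.
Qed.

Lemma zsum_ext (f g : Z -> R) : (forall n, f n = g n) -> zsum f = zsum g.
Proof. intros H; apply Series_ext, zpair_ext, H. Qed.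

Lemma zsum_plus (f g : Z -> R) : zsummable f -> zsummable g ->
  zsum (fun n => f n + g n) = zsum f + zsum g.
Proof.
  intros Hf Hg; unfold zsum; rewrite <- Series_plus by now apply zsummable_ex.
  apply Series_ext; intros; apply zpair_plus.
Qed.

Lemma zsum_scal x (f : Z -> R) : zsum (fun n => x * f n) = x * zsum f.
Proof.
  unfold zsum; rewrite <- Series_scal_l; apply Series_ext; intros; apply zpair_scal.
Qed.

Lemma zsum_ge0 (f : Z -> R) : (forall n, 0 <= f n) -> zsummable f -> 0 <= zsum f.
Proof.
  intros H Hf; replace 0 with (Series (fun _ => 0 * 0)) by (rewrite Series_scal_l; ring).
  apply Series_le; [|now apply zsummable_ex].
  intros k; generalize (zpair_ge0 f H k); lra.
Qed.

Lemma zsum_minus (f g : Z -> R) : zsummable f -> zsummable g ->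
  zsum (fun n => f n - g n) = zsum f - zsum g.
Proof.
  intros Hf Hg; rewrite (zsum_ext _ (fun n => f n + (-1) * g n)) by (intros; ring).
  rewrite zsum_plus, zsum_scal; [ring | assumption | now apply zsummable_scal].
Qed.

Lemma zsummable_minus (f g : Z -> R) :
  zsummable f -> zsummable g -> zsummable (fun n => f n - g n).
Proof.
  intros Hf Hg; apply (zsummable_ext (fun n => f n + (-1) * g n)); [intros; ring|].
  apply zsummable_plus; [|apply zsummable_scal]; assumption.
Qed.

Lemma zsum_le (f g : Z -> R) : (forall n, f n <= g n) -> zsummable f -> zsummable g ->
  zsum f <= zsum g.
Proof.
  intros H Hf Hg; apply Rminus_le_0; rewrite <- zsum_minus by assumption.
  apply zsum_ge0; [intros n; specialize (H n); lra | now apply zsummable_minus].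
Qed.

Lemma is_series_single (x : R) (m : nat) :
  is_series (fun k => if Nat.eq_dec k m then x else 0) x.
Proof.
  apply (is_lim_seq_ext_loc (fun _ => x) _ x); [|apply is_lim_seq_const].
  exists m; intros n Hn; symmetry.
  rewrite sum_n_Reals; revert Hn; induction n as [|n IH]; intros Hn.
  - simpl; destruct m; [reflexivity | lia].
  - rewrite tech5; destruct (Nat.eq_dec (S n) m) as [E|E]; [|rewrite IH by lia; ring].
    rewrite (sum_eq _ (fun _ => 0)); [rewrite sum_cte; ring|].
    intros i Hi; destruct (Nat.eq_dec i m); [lia | reflexivity].
Qed.

Definition zunit (n m : Z) : R := if Z.eq_dec m n then 1 else 0.

Lemma zpair_unit n k : zpair (zunit n) k = if Nat.eq_dec k (Z.abs_nat n) then 1 else 0.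
Proof.
  destruct k as [|k]; unfold zpair, zunit;
    repeat (match goal with |- context [if ?x then _ else _] => destruct x end);
    try lia; ring.
Qed.

Lemma zsummable_unit n : zsummable (zunit n).
Proof.
  eexists; eapply is_series_ext; [|apply (is_series_single 1 (Z.abs_nat n))].
  intros k; simpl; rewrite <- zpair_unit; apply zpair_ext; intros m.
  rewrite Rabs_pos_eq; [reflexivity|]; unfold zunit; destruct (Z.eq_dec m n); lra.
Qed.

Lemma zsum_unit n : zsum (zunit n) = 1.
Proof.
  apply is_series_unique; eapply is_series_ext; [|apply (is_series_single 1 (Z.abs_nat n))].
  intros k; simpl; now rewrite <- zpair_unit.
Qed.

Section FiniteSupport.
Context (f : Z -> R) (n : Z).
Context (H : forall m, m <> (n - 1)%Z -> m <> n -> f m = 0).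

Let eqf m : f (n - 1)%Z * zunit (n - 1) m + f n * zunit n m = f m.
Proof.
  unfold zunit; destruct (Z.eq_dec m (n - 1)), (Z.eq_dec m n); subst; try lia; try ring.
  rewrite (H m) by assumption; ring.
Qed.

Lemma zsummable_two : zsummable f.
Proof.
  eapply zsummable_ext; [apply eqf|].
  apply zsummable_plus; apply zsummable_scal, zsummable_unit.
Qed.

(** The differences at [n - 1] and [n] are those that involve the entry at [n]; one-site
    perturbations are evaluated through this formula. *)
Lemma zsum_two : zsum f = f (n - 1)%Z + f n.
Proof.
  rewrite (zsum_ext _ _ (fun m => eq_sym (eqf m))).
  rewrite zsum_plus, !zsum_scal, !zsum_unit by apply zsummable_scal, zsummable_unit; ring.
Qed.
End FiniteSupport.

Lemma zsum_ge_term (f : Z -> R) n :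
  (forall m, 0 <= f m) -> zsummable f -> f n <= zsum f.
Proof.
  intros H Hf; replace (f n) with (zsum (fun m => f n * zunit n m))
    by (rewrite zsum_scal, zsum_unit; ring).
  apply zsum_le; [|apply zsummable_scal, zsummable_unit | assumption].
  intros m; unfold zunit; destruct (Z.eq_dec m n); [subst; lra|].
  rewrite Rmult_0_r; apply H.
Qed.

Lemma zsum_gt0 (f : Z -> R) :
  (forall m, 0 <= f m) -> (exists n, 0 < f n) -> zsummable f -> 0 < zsum f.
Proof. intros H [n Hn] Hf; generalize (zsum_ge_term f n H Hf); lra. Qed.

(** * Passage to the limit under the sum *)

Lemma sum_n_le_Series (x : nat -> R) N :
  (forall k, 0 <= x k) -> ex_series x -> sum_n x N <= Series x.
Proof.
  intros H Hx; apply (is_lim_seq_incr_compare (sum_n x)).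
  - apply Series_correct, Hx.
  - intros k; rewrite sum_Sn; change plus with Rplus; simpl; generalize (H (S k)); lra.
Qed.

Lemma is_lim_seq_sum_n (x : nat -> nat -> R) (y : nat -> R) N :
  (forall j, is_lim_seq (fun k => x k j) (y j)) ->
  is_lim_seq (fun k => sum_n (x k) N) (sum_n y N).
Proof.
  intros H; induction N as [|N IH].
  - rewrite sum_O; eapply is_lim_seq_ext; [|apply (H 0%nat)]; intros; now rewrite sum_O.
  - rewrite sum_Sn; apply (is_lim_seq_ext (fun k => sum_n (x k) N + x k (S N)));
      [intros k; now rewrite sum_Sn|].
    now apply (is_lim_seq_plus' _ _ _ _ IH).
Qed.

Lemma Series_tail (x : nat -> R) :
  ex_series x -> is_lim_seq (fun N => Series x - sum_n x N) 0.
Proof.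
  intros H; replace (Finite 0) with (Finite (Series x - Series x)) by (f_equal; ring).
  apply is_lim_seq_minus'; [apply is_lim_seq_const | apply Series_correct, H].
Qed.

(** Tannery's theorem: the tail of [g] bounds the tails of all [x k] and of [y], and finitely many
    terms converge. The budget is eps/4 for each of the two tails and eps/2 for the finite part. *)
Lemma Series_dominated (x : nat -> nat -> R) (y g : nat -> R) :
  (forall k j, Rabs (x k j) <= g j) -> ex_series g ->
  (forall j, is_lim_seq (fun k => x k j) (y j)) ->
  is_lim_seq (fun k => Series (x k)) (Series y).
Proof.
  intros Hx Hg Hl.
  assert (Hy : forall j, Rabs (y j) <= g j).
  { intros j; apply (is_lim_seq_le (fun k => Rabs (x k j)) (fun _ => g j)
      (Rabs (y j)) (g j)); [intros; apply Hx | | apply is_lim_seq_const].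
    apply (is_lim_seq_abs _ (y j)), Hl. }
  assert (tail : forall z N, (forall j, Rabs (z j) <= g j) ->
    Rabs (Series z - sum_n z N) <= Series g - sum_n g N).
  { intros z N Hz.
    assert (ez : ex_series z).
    { apply (@ex_series_le R_AbsRing R_CompleteNormedModule z g); [exact Hz | exact Hg]. }
    rewrite (Series_incr_n z (S N)), (Series_incr_n g (S N)), !sum_n_Reals
      by (lia || assumption); simpl.
    replace (_ - _) with (Series (fun k => z (S (N + k)))) by ring.
    replace (_ - _) with (Series (fun k => g (S (N + k)))) by ring.
    assert (eg : ex_series (fun k => g (S (N + k)))) by (apply (ex_series_incr_n g (S N)), Hg).
    eapply Rle_trans; [apply Series_Rabs|].
    - apply (@ex_series_le R_AbsRing R_CompleteNormedModule _ (fun k => g (S (N + k))));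
        [|exact eg].
      intros k; change (norm (Rabs (z (S (N + k))))) with (Rabs (Rabs (z (S (N + k))))).
      rewrite Rabs_Rabsolu; apply Hz.
    - apply Series_le; [|exact eg]; intros k; split; [apply Rabs_pos | apply Hz]. }
  apply is_lim_seq_spec; intros eps.
  destruct (proj2 (is_lim_seq_spec _ _) (Series_tail g Hg) (pos_div_2 (pos_div_2 eps)))
    as [N HN].
  specialize (HN N (le_n N)); simpl in HN; rewrite Rminus_0_r in HN.
  destruct (proj2 (is_lim_seq_spec _ _) (is_lim_seq_sum_n x y N Hl) (pos_div_2 eps))
    as [K HK].
  exists K; intros k Hk; specialize (HK k Hk); simpl in HK.
  generalize (tail (x k) N (Hx k)) (tail y N Hy).
  apply Rabs_def2 in HN; apply Rabs_def2 in HK.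
  intros H1%Rabs_le_between H2%Rabs_le_between; apply Rabs_def1; lra.
Qed.

Lemma zsum_dominated (F : nat -> Z -> R) (f g : Z -> R) :
  (forall k n, Rabs (F k n) <= g n) -> zsummable g ->
  (forall n, is_lim_seq (fun k => F k n) (f n)) ->
  is_lim_seq (fun k => zsum (F k)) (zsum f).
Proof.
  intros HF Hg Hl; apply (Series_dominated _ _ (zpair g)).
  - intros k j; eapply Rle_trans; [apply zpair_abs | apply zpair_le, HF].
  - now apply zsummable_ex.
  - intros [|j]; simpl; [apply Hl | apply is_lim_seq_plus'; apply Hl].
Qed.

(** Fatou's lemma: every partial sum passes to the limit and stays below [l]. The bound is a
    convergent sequence because it is applied both to a constant and to an energy bound that varies
    with [k]; the summability of [f] is what puts limits into [E]. *)
Lemma zsum_fatou (F : nat -> Z -> R) (f : Z -> R) (x : nat -> R) (l : R) :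
  (forall k n, 0 <= F k n) -> (forall k, zsummable (F k)) ->
  (forall n, is_lim_seq (fun k => F k n) (f n)) ->
  (forall k, zsum (F k) <= x k) -> is_lim_seq x l ->
  zsummable f /\ zsum f <= l.
Proof.
  intros H0 Hs Hl Hx Hxl.
  assert (f0 : forall n, 0 <= f n).
  { intros n; apply (is_lim_seq_le (fun _ => 0) (fun k => F k n) 0 (f n));
      [intros; apply H0 | apply is_lim_seq_const | apply Hl]. }
  assert (HN : forall N, sum_n (zpair f) N <= l).
  { intros N; apply (is_lim_seq_le (fun k => sum_n (zpair (F k)) N) x
      (sum_n (zpair f) N) l); [| |exact Hxl].
    - intros k; eapply Rle_trans; [|apply Hx].
      apply sum_n_le_Series; [apply zpair_ge0, H0 | apply zsummable_ex, Hs].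
    - apply is_lim_seq_sum_n; intros [|j]; simpl; [apply Hl | apply is_lim_seq_plus'; apply Hl]. }
  assert (incr : forall N, sum_n (zpair f) N <= sum_n (zpair f) (S N)).
  { intros N; rewrite sum_Sn; change plus with Rplus; simpl.
    generalize (zpair_ge0 f f0 (S N)); simpl; lra. }
  destruct (ex_finite_lim_seq_incr _ _ incr HN) as [s Hs'].
  assert (Es : is_series (zpair f) s) by exact Hs'.
  split.
  - exists s; eapply is_series_ext; [|exact Es].
    apply zpair_ext; intros n; now rewrite Rabs_pos_eq.
  - unfold zsum; rewrite (is_series_unique _ _ Es).
    apply (is_lim_seq_le (sum_n (zpair f)) (fun _ => l) s l);
      [exact HN | exact Es | apply is_lim_seq_const].
Qed.

(** * Real powers *)

Lemma rpow_0 s : rpow 0 s = 0.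
Proof. unfold rpow; destruct (Req_EM_T 0 0); [reflexivity | lra]. Qed.

Lemma rpow_Rpower x s : x <> 0 -> rpow x s = Rpower x s.
Proof. intros H; unfold rpow; destruct (Req_EM_T x 0); [lra | reflexivity]. Qed.

Lemma rpow_gt0 x s : x <> 0 -> 0 < rpow x s.
Proof. intros H; rewrite rpow_Rpower by assumption; apply exp_pos. Qed.

Lemma rpow_ge0 x s : 0 <= rpow x s.
Proof.
  destruct (Req_EM_T x 0) as [->|H]; [rewrite rpow_0; lra | now apply Rlt_le, rpow_gt0].
Qed.

Lemma rpow_1 s : rpow 1 s = 1.
Proof. rewrite rpow_Rpower by lra; unfold Rpower; rewrite ln_1, Rmult_0_r; apply exp_0. Qed.

Lemma rpow_x1 x : 0 <= x -> rpow x 1 = x.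
Proof.
  intros [H| <-]; [|apply rpow_0]; rewrite rpow_Rpower by lra; now apply Rpower_1.
Qed.

Lemma rpow_mult x y s : 0 <= x -> 0 <= y -> rpow (x * y) s = rpow x s * rpow y s.
Proof.
  intros [Hx| <-] [Hy| <-]; rewrite ?Rmult_0_l, ?Rmult_0_r, ?rpow_0; try ring.
  rewrite !rpow_Rpower by nra; symmetry; now apply Rpower_mult_distr.
Qed.

Lemma rpow_plus x s t : rpow x (s + t) = rpow x s * rpow x t.
Proof.
  destruct (Req_EM_T x 0) as [->|H]; [rewrite !rpow_0; ring|].
  rewrite !rpow_Rpower by assumption; apply Rpower_plus.
Qed.

Lemma rpow_rpow x s t : rpow (rpow x s) t = rpow x (s * t).
Proof.
  destruct (Req_EM_T x 0) as [->|H]; [now rewrite !rpow_0|].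
  rewrite (rpow_Rpower (rpow x s)) by (generalize (rpow_gt0 x s H); lra).
  rewrite !rpow_Rpower by assumption; apply Rpower_mult.
Qed.

Lemma rpow_le x y s : 0 <= s -> 0 <= x <= y -> rpow x s <= rpow y s.
Proof.
  intros Hs [[Hx| <-] Hxy]; [|rewrite rpow_0; apply rpow_ge0].
  rewrite !rpow_Rpower by lra; apply Rle_Rpower_l; lra.
Qed.

Lemma rpow_lt x y s : 0 < s -> 0 <= x < y -> rpow x s < rpow y s.
Proof.
  intros Hs [[Hx| <-] Hxy]; [|rewrite rpow_0; apply rpow_gt0; lra].
  rewrite !rpow_Rpower by lra; apply Rlt_Rpower_l; lra.
Qed.

Lemma ln_rpow x s : x <> 0 -> ln (rpow x s) = s * ln x.
Proof. intros H; rewrite rpow_Rpower by assumption; apply ln_Rpower. Qed.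

Lemma Rabs_sqr_rpow s x : rpow (Rabs x) (s - 2) * x * x = rpow (Rabs x) s.
Proof.
  replace s with (s - 2 + 1 + 1) at 2 by ring; rewrite !rpow_plus.
  rewrite rpow_x1 by apply Rabs_pos; rewrite !Rmult_assoc; f_equal.
  rewrite <- Rabs_mult, Rabs_pos_eq; [reflexivity | nra].
Qed.

Lemma phi_mult_self s x : phi s x * x = rpow (Rabs x) s.
Proof. apply Rabs_sqr_rpow. Qed.

Lemma Rabs_phi s x : Rabs (phi s x) = rpow (Rabs x) (s - 1).
Proof.
  unfold phi; rewrite Rabs_mult, (Rabs_pos_eq (rpow _ _)) by apply rpow_ge0.
  replace (s - 1) with (s - 2 + 1) by ring; rewrite rpow_plus, (rpow_x1 (Rabs x)); [reflexivity|].
  apply Rabs_pos.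
Qed.

Lemma phi_0 s : phi s 0 = 0.
Proof. unfold phi; ring. Qed.

(** From exp(y) >= 1 + y at y = - ln x. With x = s^q, the gap measures how far a point lies below
    the top of its fiber. *)
Lemma xlnx_ge x : 0 <= x -> x - 1 <= x * ln x.
Proof.
  intros [H| <-]; [|lra].
  assert (L := exp_ineq1_le (- ln x)); rewrite exp_Ropp, exp_ln in L by assumption.
  assert (x * (1 + - ln x) <= x * / x) by (apply Rmult_le_compat_l; lra).
  rewrite Rinv_r in H0 by lra; nra.
Qed.

Lemma xlnx_gt x : 0 <= x -> x <> 1 -> x - 1 < x * ln x.
Proof.
  intros [H| <-] H1; [|lra].
  assert (E : - ln x <> 0).
  { intros E; apply H1, ln_inv; [assumption | lra | rewrite ln_1; lra]. }
  assert (L := exp_ineq1 _ E); rewrite exp_Ropp, exp_ln in L by assumption.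
  assert (x * (1 + - ln x) < x * / x) by (apply Rmult_lt_compat_l; lra).
  rewrite Rinv_r in H0 by lra; nra.
Qed.

(** x^s = x exp((s - 1) ln x) >= x + (s - 1) x ln x, and x ln x >= x - 1. *)
Lemma bernoulli x s : 1 <= s -> 0 <= x -> 1 + s * (x - 1) <= rpow x s.
Proof.
  intros Hs [Hx| <-]; [|rewrite rpow_0; nra].
  replace s with (1 + (s - 1)) at 2 by ring.
  rewrite rpow_plus, rpow_x1, (rpow_Rpower x (s - 1)) by lra.
  unfold Rpower.
  assert (L := exp_ineq1_le ((s - 1) * ln x)).
  assert (x * (1 + (s - 1) * ln x) <= x * exp ((s - 1) * ln x))
    by (apply Rmult_le_compat_l; lra).
  assert (X := xlnx_ge x ltac:(lra)); nra.
Qed.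

(** By homogeneity, y = z x reduces the claim to Bernoulli's inequality for z; for z < 0 the affine
    side 1 + s (z - 1) is negative. *)
Lemma rpow_tangent s x y :
  1 < s -> rpow (Rabs x) s + s * phi s x * (y - x) <= rpow (Rabs y) s.
Proof.
  intros Hs; destruct (Req_EM_T x 0) as [->|Hx].
  { rewrite Rabs_R0, rpow_0, phi_0; generalize (rpow_ge0 (Rabs y) s); nra. }
  set (z := y / x).
  assert (Ey : y = z * x) by (unfold z; field; assumption).
  rewrite Ey, Rabs_mult, rpow_mult by apply Rabs_pos.
  replace (s * phi s x * (z * x - x)) with (s * (z - 1) * (phi s x * x)) by ring.
  rewrite phi_mult_self.
  assert (P := rpow_gt0 (Rabs x) s (Rabs_no_R0 _ Hx)).
  assert (1 + s * (z - 1) <= rpow (Rabs z) s); [|nra].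
  destruct (Rle_dec 0 z).
  - rewrite Rabs_pos_eq by assumption; apply bernoulli; lra.
  - generalize (rpow_ge0 (Rabs z) s); nra.
Qed.

(** Bernoulli's inequality for x^s with exponent t/s. It trades the exponent q of the weights for
    the exponent p of the norm; this is where p < q enters the fibering inequality. *)
Lemma rpow_exponents s t x : 0 < s -> s < t -> 0 <= x ->
  (1 - rpow x t) / t <= (1 - rpow x s) / s.
Proof.
  intros Hs Hst Hx.
  assert (B := bernoulli (rpow x s) (t / s)).
  rewrite rpow_rpow in B; replace (s * (t / s)) with t in B by (field; lra).
  assert (1 <= t / s) by (apply Rmult_le_reg_r with s; [lra|]; field_simplify; lra).
  specialize (B H (rpow_ge0 _ _)).
  apply Rmult_le_reg_r with t; [lra|].
  replace ((1 - rpow x t) / t * t) with (1 - rpow x t) by (field; lra).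
  replace ((1 - rpow x s) / s * t) with (t / s * (1 - rpow x s)) by (field; lra).
  lra.
Qed.

(* With [S = A + B] and [A = alpha S], [B = (1 - alpha) S], the left side is bounded by
   [(1 - sigma^q) / q |S|^p], [sigma = alpha s + (1 - alpha) t], by convexity of the
   [q]-th power. *)
Lemma rpow_fibering p q A B s t : 1 < p -> p < q -> 0 <= s -> 0 <= t -> 0 <= A * B ->
  (1 - rpow s q) / q * (phi p (A + B) * A) + (1 - rpow t q) / q * (phi p (A + B) * B)
  <= 1 / p * (rpow (Rabs (A + B)) p - rpow (Rabs (s * A + t * B)) p).
Proof.
  intros Hp Hpq Hs Ht HAB.
  destruct (Req_EM_T (A + B) 0) as [E|HS].
  { assert (A = 0) by nra; assert (B = 0) by lra; subst.
    rewrite !Rmult_0_r, Rplus_0_r, Rabs_R0, rpow_0; lra. }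
  set (S := A + B) in *; set (al := A / S).
  assert (EA : A = al * S) by (unfold al; field; assumption).
  assert (EB : B = (1 - al) * S) by (unfold al, S in *; field; assumption).
  assert (S2 : 0 < S * S) by nra.
  assert (al0 : 0 <= al <= 1).
  { rewrite EA, EB in HAB; assert (0 <= al * (1 - al)) by nra; nra. }
  rewrite EA, EB.
  replace (s * (al * S) + t * ((1 - al) * S)) with ((s * al + t * (1 - al)) * S) by ring.
  set (si := s * al + t * (1 - al)).
  assert (si0 : 0 <= si) by (unfold si; nra).
  rewrite Rabs_mult, rpow_mult, (Rabs_pos_eq si) by (apply Rabs_pos || assumption).
  replace (phi p S * (al * S)) with (al * (phi p S * S)) by ring.
  replace (phi p S * ((1 - al) * S)) with ((1 - al) * (phi p S * S)) by ring.
  rewrite phi_mult_self.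
  assert (P := rpow_gt0 (Rabs S) p (Rabs_no_R0 _ HS)).
  assert (X := rpow_exponents p q si ltac:(lra) Hpq si0).
  assert (Ts := rpow_tangent q si s ltac:(lra)); assert (Tt := rpow_tangent q si t ltac:(lra)).
  rewrite !Rabs_pos_eq in Ts, Tt by assumption.
  assert (Y : rpow si q <= al * rpow s q + (1 - al) * rpow t q).
  { apply Rle_trans with (al * (rpow si q + q * phi q si * (s - si))
                          + (1 - al) * (rpow si q + q * phi q si * (t - si))); [|nra].
    apply Req_le; unfold si; ring. }
  assert (Z : al * ((1 - rpow s q) / q) + (1 - al) * ((1 - rpow t q) / q)
              <= (1 - rpow si q) / q).
  { apply Rmult_le_reg_r with q; [lra|].
    replace (_ * q) with (al * (1 - rpow s q) + (1 - al) * (1 - rpow t q)) by (field; lra).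
    replace ((1 - rpow si q) / q * q) with (1 - rpow si q) by (field; lra). lra. }
  replace (1 / p * (rpow (Rabs S) p - rpow si p * rpow (Rabs S) p))
    with ((1 - rpow si p) / p * rpow (Rabs S) p) by (field; lra).
  nra.
Qed.

Lemma Rabs_plus_same_sign A B : 0 <= A * B -> Rabs (A + B) = Rabs A + Rabs B.
Proof.
  intros H; unfold Rabs; destruct (Rcase_abs A), (Rcase_abs B), (Rcase_abs (A + B)); nra.
Qed.

(** |A|^p = |A| |A|^(p-1), whose last factor is at most (|A| + |B|)^(p-1); likewise for B. *)
Lemma rpow_superadd p A B : 1 <= p -> 0 <= A * B ->
  rpow (Rabs A) p + rpow (Rabs B) p <= rpow (Rabs (A + B)) p.
Proof.
  intros Hp H; rewrite Rabs_plus_same_sign by assumption.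
  replace p with (1 + (p - 1)) by ring; rewrite !rpow_plus, !rpow_x1.
  2,3,4: generalize (Rabs_pos A) (Rabs_pos B); lra.
  assert (rpow (Rabs A) (p - 1) <= rpow (Rabs A + Rabs B) (p - 1))
    by (apply rpow_le; generalize (Rabs_pos A) (Rabs_pos B); lra).
  assert (rpow (Rabs B) (p - 1) <= rpow (Rabs A + Rabs B) (p - 1))
    by (apply rpow_le; generalize (Rabs_pos A) (Rabs_pos B); lra).
  generalize (Rabs_pos A) (Rabs_pos B); nra.
Qed.

(** The left side is |x|^(p-1) |y|, at most the p-th power of the larger modulus. This crude Young
    inequality makes the norm pairing of two sequences of [E] summable. *)
Lemma Rabs_le_pow_sum x y p : 1 < p ->
  Rabs (rpow (Rabs x) (p - 2) * x * y) <= rpow (Rabs x) p + rpow (Rabs y) p.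
Proof.
  intros Hp; change (rpow (Rabs x) (p - 2) * x) with (phi p x).
  rewrite Rabs_mult, Rabs_phi.
  assert (E : forall z, rpow (Rabs z) p = rpow (Rabs z) (p - 1) * Rabs z).
  { intros z; rewrite <- (rpow_x1 (Rabs z)) at 3 by apply Rabs_pos.
    rewrite <- rpow_plus; f_equal; ring. }
  assert (X := rpow_ge0 (Rabs x) p); assert (Y := rpow_ge0 (Rabs y) p).
  destruct (Rle_dec (Rabs y) (Rabs x)) as [H|H].
  - generalize (rpow_ge0 (Rabs x) (p - 1)); rewrite (E x) in *; nra.
  - assert (rpow (Rabs x) (p - 1) <= rpow (Rabs y) (p - 1))
      by (apply rpow_le; generalize (Rabs_pos x); lra).
    generalize (Rabs_pos y); rewrite (E y) in *; nra.
Qed.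

Lemma rpow_Rabs_plus x y p : 0 < p ->
  rpow (Rabs (x + y)) p <= rpow 2 p * (rpow (Rabs x) p + rpow (Rabs y) p).
Proof.
  intros Hp; assert (T := Rabs_triang x y).
  assert (P2 := rpow_ge0 2 p).
  assert (X := rpow_ge0 (Rabs x) p); assert (Y := rpow_ge0 (Rabs y) p).
  destruct (Rle_dec (Rabs x) (Rabs y)) as [H|H].
  - apply Rle_trans with (rpow (2 * Rabs y) p).
    + apply rpow_le; [lra|]; generalize (Rabs_pos (x + y)); lra.
    + rewrite rpow_mult by (lra || apply Rabs_pos); nra.
  - apply Rle_trans with (rpow (2 * Rabs x) p).
    + apply rpow_le; [lra|]; generalize (Rabs_pos (x + y)); lra.
    + rewrite rpow_mult by (lra || apply Rabs_pos); nra.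
Qed.

(** Equal signs turn [phi p S * Y] into |S|^(p-1) |Y|, which grows with |S|. With Z the increment of
    a deleted component, deletion lowers the pairing of the norm with the remaining parts. *)
Lemma phi_mono_same_sign p X Y Z : 1 < p -> 0 <= X * Y -> 0 <= X * Z -> 0 <= Y * Z ->
  phi p (X + Y) * Y <= phi p (X + Y + Z) * Y.
Proof.
  intros Hp HXY HXZ HYZ.
  destruct (Req_EM_T Y 0) as [->|HY]; [lra|].
  assert (P : forall S, 0 <= S * Y -> phi p S * Y = rpow (Rabs S) (p - 1) * Rabs Y).
  { intros S HS; rewrite <- Rabs_phi, <- Rabs_mult, Rabs_pos_eq; [reflexivity|].
    unfold phi; rewrite Rmult_assoc; apply Rmult_le_pos; [apply rpow_ge0 | assumption]. }
  rewrite !P by nra.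
  apply Rmult_le_compat_r; [apply Rabs_pos|]; apply rpow_le; [lra|].
  split; [apply Rabs_pos|].
  rewrite (Rabs_plus_same_sign (X + Y) Z) by nra.
  generalize (Rabs_pos Z); lra.
Qed.

(** For y = x^(s/2) the left side is (2/s) y (- y ln y), and - y ln y <= 1 - y <= 1: half of the
    power is spent on the logarithm. *)
Lemma rpow_ln_bound s x : 0 < s -> 0 < x <= 1 ->
  rpow x s * Rabs (ln x) <= 2 / s * rpow x (s / 2).
Proof.
  intros Hs Hx.
  assert (L : ln x <= 0) by (rewrite <- ln_1; apply ln_le; lra).
  rewrite Rabs_left1 by assumption.
  replace s with (s / 2 + s / 2) at 1 by field; rewrite rpow_plus.
  set (y := rpow x (s / 2)).
  assert (y0 : 0 < y) by (apply rpow_gt0; lra).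
  assert (Ey : ln y = s / 2 * ln x) by (apply ln_rpow; lra).
  assert (X := xlnx_ge y ltac:(lra)); rewrite Ey in X.
  apply Rmult_le_reg_r with (s / 2); [lra|].
  replace (2 / s * y * (s / 2)) with y by (field; lra).
  nra.
Qed.

Lemma rpow_small s eps : 0 < s -> 0 < eps ->
  exists d, 0 < d /\ forall x, 0 <= x < d -> rpow x s < eps.
Proof.
  intros Hs He; exists (rpow eps (/ s)); split; [apply rpow_gt0; lra|].
  intros x Hx; apply Rlt_le_trans with (rpow (rpow eps (/ s)) s); [now apply rpow_lt|].
  rewrite rpow_rpow, Rinv_l, rpow_x1; lra.
Qed.

Lemma rpow_ln_small s eps : 0 < s -> 0 < eps ->
  exists d, 0 < d /\ forall x, 0 <= x < d -> Rabs (rpow x s * ln x) < eps.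
Proof.
  intros Hs He; destruct (rpow_small (s / 2) (s / 2 * eps)) as [d [Hd H]]; try nra.
  exists (Rmin d 1); split; [now apply Rmin_pos; lra|].
  intros x Hx; assert (x < d /\ x < 1) as [H1 H2]
    by (generalize (Rmin_l d 1) (Rmin_r d 1); lra).
  destruct (Req_EM_T x 0) as [->|Hx0]; [rewrite rpow_0, Rmult_0_l, Rabs_R0; lra|].
  rewrite Rabs_mult, (Rabs_pos_eq (rpow _ _)) by apply rpow_ge0.
  eapply Rle_lt_trans; [apply rpow_ln_bound; lra|].
  specialize (H x ltac:(lra)).
  apply Rmult_lt_reg_l with (s / 2); [lra|].
  replace (s / 2 * (2 / s * rpow x (s / 2))) with (rpow x (s / 2)) by (field; lra); lra.
Qed.

(** * Differentiability and continuity of powers, zero included *)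

Lemma is_derive_ln_Rabs x : x <> 0 -> is_derive (fun y => ln (Rabs y)) x (/ x).
Proof.
  intros Hx; destruct (Rdichotomy _ _ Hx) as [H|H].
  - apply (is_derive_ext_loc (fun y => ln (- y))).
    + exists (mkposreal (- x) ltac:(lra)); intros y Hy%Rabs_lt_between'; simpl in Hy.
      rewrite Rabs_left by lra; reflexivity.
    + auto_derive; [lra | field; lra].
  - apply (is_derive_ext_loc ln).
    + exists (mkposreal x ltac:(lra)); intros y Hy%Rabs_lt_between'; simpl in Hy.
      rewrite Rabs_pos_eq by lra; reflexivity.
    + auto_derive; [lra | field; lra].
Qed.

Lemma is_derive_rpow_nz s x : x <> 0 ->
  is_derive (fun y => rpow (Rabs y) s) x (s * phi s x).
Proof.
  intros Hx; apply (is_derive_ext_loc (fun y => exp (s * ln (Rabs y)))).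
  { exists (mkposreal (Rabs x) (Rabs_pos_lt _ Hx)); intros y Hy.
    change (Rabs (y - x) < Rabs x) in Hy.
    rewrite rpow_Rpower; [reflexivity|]; intros E; apply Rabs_eq_0 in E; subst.
    rewrite Rminus_0_l, Rabs_Ropp in Hy; lra. }
  assert (E : s * phi s x = scal (scal s (/ x)) (exp (s * ln (Rabs x)))).
  { change (s * phi s x = s * / x * Rpower (Rabs x) s).
    rewrite <- rpow_Rpower by now apply Rabs_no_R0.
    rewrite <- phi_mult_self; field; assumption. }
  rewrite E.
  apply (is_derive_comp exp (fun y => s * ln (Rabs y))).
  - apply is_derive_exp.
  - apply is_derive_scal, is_derive_ln_Rabs, Hx.
Qed.

Lemma is_derive_rpow s x : 1 < s ->
  is_derive (fun y => rpow (Rabs y) s) x (s * phi s x).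
Proof.
  intros Hs; destruct (Req_EM_T x 0) as [->|Hx]; [|now apply is_derive_rpow_nz].
  apply is_derive_Reals; intros eps He.
  destruct (rpow_small (s - 1) eps) as [d [Hd H]]; try lra.
  exists (mkposreal d Hd); intros h Hh Hd'; simpl in Hd'.
  rewrite phi_0, Rplus_0_l, Rabs_R0, rpow_0, Rmult_0_r, !Rminus_0_r.
  rewrite <- phi_mult_self; replace (phi s h * h / h) with (phi s h) by (field; assumption).
  rewrite Rabs_phi; apply H; split; [apply Rabs_pos | assumption].
Qed.

(** At 0 the difference quotient has modulus |h|^(s-1) |ln|h||, which tends to 0 because s > 1. The
    energy can therefore be differentiated in an entry that vanishes. *)
Lemma is_derive_rpow_ln s x : 1 < s ->
  is_derive (fun y => rpow (Rabs y) s * ln (Rabs y)) x (phi s x * (s * ln (Rabs x) + 1)).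
Proof.
  intros Hs; destruct (Req_EM_T x 0) as [->|Hx].
  - apply is_derive_Reals; intros eps He.
    destruct (rpow_ln_small (s - 1) eps) as [d [Hd H]]; try lra.
    exists (mkposreal d Hd); intros h Hh Hd'; simpl in Hd'.
    rewrite phi_0, Rplus_0_l, Rabs_R0, rpow_0, !Rmult_0_l, !Rminus_0_r.
    rewrite <- phi_mult_self.
    replace (phi s h * h * ln (Rabs h) / h) with (phi s h * ln (Rabs h))
      by (field; assumption).
    rewrite Rabs_mult, Rabs_phi.
    rewrite <- (Rabs_pos_eq (rpow _ _)), <- Rabs_mult by apply rpow_ge0.
    apply H; split; [apply Rabs_pos | assumption].
  - replace (phi s x * (s * ln (Rabs x) + 1))
      with (s * phi s x * ln (Rabs x) + rpow (Rabs x) s * / x)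
      by (rewrite <- phi_mult_self; field; assumption).
    apply (is_derive_mult (fun y => rpow (Rabs y) s) (fun y => ln (Rabs y))).
    + now apply is_derive_rpow_nz.
    + now apply is_derive_ln_Rabs.
    + intros; apply Rmult_comm.
Qed.

Lemma is_derive_continuous (f : R -> R) x l : is_derive f x l -> continuous f x.
Proof. intros H; apply (ex_derive_continuous f); now exists l. Qed.

Lemma continuous_phi s x : 1 < s -> continuous (phi s) x.
Proof.
  intros Hs; destruct (Req_EM_T x 0) as [->|Hx].
  - apply continuity_pt_filterlim; intros eps He.
    destruct (rpow_small (s - 1) eps) as [d [Hd H]]; try lra.
    exists d; split; [assumption|]; intros y [_ Hy].
    unfold dist in *; simpl in *; unfold R_dist in *.
    rewrite Rminus_0_r in Hy; rewrite phi_0, Rminus_0_r, Rabs_phi.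
    apply H; split; [apply Rabs_pos | assumption].
  - apply (continuous_mult (fun y => rpow (Rabs y) (s - 2)) (fun y => y)).
    + eapply is_derive_continuous, is_derive_rpow_nz, Hx.
    + apply continuous_id.
Qed.

Lemma continuous_phi_ln s x : 1 < s -> continuous (fun y => phi s y * ln (Rabs y)) x.
Proof.
  intros Hs; destruct (Req_EM_T x 0) as [->|Hx].
  - apply continuity_pt_filterlim; intros eps He.
    destruct (rpow_ln_small (s - 1) eps) as [d [Hd H]]; try lra.
    exists d; split; [assumption|]; intros y [_ Hy].
    unfold dist in *; simpl in *; unfold R_dist in *.
    rewrite Rminus_0_r in Hy; rewrite phi_0, Rmult_0_l, Rminus_0_r, Rabs_mult, Rabs_phi.
    rewrite <- (Rabs_pos_eq (rpow _ _)), <- Rabs_mult by apply rpow_ge0.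
    apply H; split; [apply Rabs_pos | assumption].
  - apply (continuous_mult (phi s) (fun y => ln (Rabs y))).
    + now apply continuous_phi.
    + eapply is_derive_continuous, is_derive_ln_Rabs, Hx.
Qed.

Lemma is_lim_seq_continuous_R (f : R -> R) (x : nat -> R) l :
  continuous f l -> is_lim_seq x l -> is_lim_seq (fun k => f (x k)) (f l).
Proof.
  intros Hf Hx; apply is_lim_seq_continuous; [|assumption].
  now apply continuity_pt_filterlim.
Qed.

Lemma is_lim_seq_rpow s (x : nat -> R) (l : R) : 1 < s -> is_lim_seq x l ->
  is_lim_seq (fun k => rpow (Rabs (x k)) s) (rpow (Rabs l) s).
Proof.
  intros Hs; apply (is_lim_seq_continuous_R (fun y => rpow (Rabs y) s)).
  now eapply is_derive_continuous, is_derive_rpow.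
Qed.

Lemma is_lim_seq_rpow_ln s (x : nat -> R) (l : R) : 1 < s -> is_lim_seq x l ->
  is_lim_seq (fun k => rpow (Rabs (x k)) s * ln (Rabs (x k)))
             (rpow (Rabs l) s * ln (Rabs l)).
Proof.
  intros Hs; apply (is_lim_seq_continuous_R (fun y => rpow (Rabs y) s * ln (Rabs y))).
  now eapply is_derive_continuous, is_derive_rpow_ln.
Qed.

Lemma continuous_bounded (f : R -> R) M : (forall x, continuous f x) ->
  exists K, 0 < K /\ forall x, Rabs x <= M -> Rabs (f x) <= K.
Proof.
  intros Hf; destruct (Rle_dec 0 M) as [HM|HM].
  2:{ exists 1; split; [lra|]; intros x Hx; generalize (Rabs_pos x); lra. }
  destruct (continuity_ab_maj (fun x => Rabs (f x)) (- M) M) as [z [Hz _]]; [lra| |].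
  { intros x _; apply continuity_pt_filterlim.
    apply (continuous_comp f Rabs); [apply Hf | apply continuous_Rabs]. }
  exists (Rabs (f z) + 1); split; [generalize (Rabs_pos (f z)); lra|].
  intros x Hx%Rabs_le_between; specialize (Hz x Hx); lra.
Qed.

(** * Extraction of convergent subsequences *)

Definition extractor (f : nat -> nat) := forall k, (f k < f (S k))%nat.

Lemma extractor_ge f : extractor f -> forall k, (k <= f k)%nat.
Proof. intros H k; induction k; [lia | specialize (H k); lia]. Qed.

Lemma extractor_lt f : extractor f -> forall j k, (j < k)%nat -> (f j < f k)%nat.
Proof.
  intros H j k; induction k; [lia|]; intros Hk; specialize (H k).
  destruct (Nat.eq_dec j k); [subst; assumption | lia].
Qed.

Lemma extractor_comp f g : extractor f -> extractor g -> extractor (fun k => f (g k)).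
Proof. intros Hf Hg k; now apply extractor_lt. Qed.

Lemma is_lim_seq_extract (x : nat -> R) l f :
  extractor f -> is_lim_seq x l -> is_lim_seq (fun k => x (f k)) l.
Proof.
  intros Hf; apply is_lim_seq_subseq; intros P [N HN]; exists N; intros k Hk; apply HN.
  generalize (extractor_ge f Hf k); lia.
Qed.

(** The limit is the upper limit. [g (k, N)] is an index at least N whose term is within 1/(k+1) of
    it; the recursion calls [g] with N just above the previous index, so the extraction is strictly
    increasing. *)
Lemma Bolzano_Weierstrass_seq (x : nat -> R) M : (forall k, Rabs (x k) <= M) ->
  exists f (l : R), extractor f /\ is_lim_seq (fun k => x (f k)) l.
Proof.
  intros HM; destruct (ex_LimSup_seq x) as [[l| |] H]; simpl in H.
  - assert (Hc : forall kN : nat * nat, exists n,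
      (snd kN <= n)%nat /\ Rabs (x n - l) < / (INR (fst kN) + 1)).
    { intros [k N]; simpl.
      assert (e : 0 < / (INR k + 1)) by (apply Rinv_0_lt_compat; generalize (pos_INR k); lra).
      destruct (H (mkposreal _ e)) as [H1 [N0 H2]]; simpl in *.
      destruct (H1 (max N N0)) as [n [Hn Hl]]; exists n; split; [lia|].
      specialize (H2 n ltac:(lia)); apply Rabs_def1; lra. }
    apply choice in Hc; destruct Hc as [g Hg].
    set (f := fix f k := match k with O => g (O, O) | S k' => g (S k', S (f k')) end).
    exists f, l; split.
    + intros k; simpl; apply (Hg (S k, S (f k))).
    + apply is_lim_seq_spec; intros eps.
      destruct (archimed_cor1 eps (cond_pos eps)) as [N [HN HN0]].
      exists N; intros k Hk; apply Rlt_trans with (/ (INR k + 1)).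
      * destruct k; apply (Hg (_, _)).
      * eapply Rle_lt_trans; [|apply HN]; apply Rinv_le_contravar; [now apply lt_0_INR|].
        apply le_INR in Hk; lra.
  - destruct (H M O) as [n [_ Hn]]; specialize (HM n); apply Rabs_le_between in HM; lra.
  - destruct (H (- M)) as [N HN]; specialize (HN N (le_n N)).
    specialize (HM N); apply Rabs_le_between in HM; lra.
Qed.

Lemma diagonal_extraction (x : nat -> nat -> R) :
  (forall j, exists M, forall k, Rabs (x k j) <= M) ->
  exists f, extractor f /\ forall j, exists l : R, is_lim_seq (fun k => x (f k) j) l.
Proof.
  intros HM.
  assert (Hc : forall fj : (nat -> nat) * nat, exists g, extractor g /\
    exists l : R, is_lim_seq (fun k => x (fst fj (g k)) (snd fj)) l).
  { intros [f j]; destruct (HM j) as [M H].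
    destruct (Bolzano_Weierstrass_seq (fun k => x (f k) j) M) as [g [l [Eg Hg]]];
      [intros; apply H|].
    exists g; split; [exact Eg | now exists l]. }
  apply choice in Hc; destruct Hc as [G HG].
  set (F := fix F j := match j with
    | O => G (fun k => k, O)
    | S j' => fun k => F j' (G (F j', S j') k) end).
  assert (FE : forall j, extractor (F j)).
  { induction j as [|j IH]; simpl; [apply (HG (fun k => k, O))|].
    apply extractor_comp; [exact IH | apply (HG (F j, S j))]. }
  assert (FL : forall j, exists l : R, is_lim_seq (fun k => x (F j k) j) l).
  { intros [|j]; [apply (HG (fun k => k, O)) | apply (HG (F j, S j))]. }
  (* [F (j + d)] is a subsequence of [F j]; from rank [j] on, the diagonal thus consists of terms of
     [F j] with indices tending to infinity. *)
  assert (FS : forall j d, exists g, extractor g /\ forall k, F (j + d)%nat k = F j (g k)).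
  { intros j d; induction d as [|d [g [Eg Hg]]].
    - exists (fun k => k); split; [intros k; lia | intros; now rewrite Nat.add_0_r].
    - exists (fun k => g (G (F (j + d)%nat, S (j + d)) k)); split.
      + apply extractor_comp; [exact Eg | apply (HG (F (j + d)%nat, S (j + d)))].
      + intros k; rewrite Nat.add_succ_r; simpl; now rewrite Hg. }
  exists (fun k => F k k); split.
  - intros k; simpl; apply extractor_lt; [apply FE|].
    generalize (extractor_ge _ (proj1 (HG (F k, S k))) (S k)); simpl; lia.
  - intros j; destruct (FL j) as [l Hl]; exists l.
    apply is_lim_seq_spec; intros eps.
    destruct (proj2 (is_lim_seq_spec _ _) Hl eps) as [N HN].
    exists (N + j)%nat; intros k Hk.
    destruct (FS j (k - j)%nat) as [g [Eg Hg]].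
    replace (j + (k - j))%nat with k in Hg by lia.
    rewrite Hg; apply HN; generalize (extractor_ge g Eg k); lia.
Qed.

Lemma diagonal_extraction_Z (u : nat -> Z -> R) M : (forall k n, Rabs (u k n) <= M) ->
  exists f (v : Z -> R), extractor f /\ forall n, is_lim_seq (fun k => u (f k) n) (v n).
Proof.
  intros HM.
  (* An enumeration of the integers: 2m goes to m and 2m + 1 to - m. Zero is hit twice; only
     surjectivity matters. *)
  pose (dec := fun j => if Nat.even j then Z.of_nat (Nat.div2 j)
                        else (- Z.of_nat (Nat.div2 j))%Z).
  destruct (diagonal_extraction (fun k j => u k (dec j))) as [f [Hf Hl]].
  { intros j; exists M; intros; apply HM. }
  assert (Hd : forall n, exists l : R, is_lim_seq (fun k => u (f k) n) l).
  { intros n; destruct (Z_le_gt_dec 0 n) as [Hn|Hn].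
    - destruct (Hl (2 * Z.abs_nat n)%nat) as [l H]; exists l.
      assert (E : dec (2 * Z.abs_nat n)%nat = n).
      { unfold dec; rewrite Nat.even_even, Nat.div2_double; lia. }
      now rewrite E in H.
    - destruct (Hl (S (2 * Z.abs_nat n))) as [l H]; exists l.
      assert (E : dec (S (2 * Z.abs_nat n)) = n).
      { unfold dec; rewrite Nat.even_succ, Nat.odd_even, Nat.div2_succ_double; lia. }
      now rewrite E in H. }
  apply choice in Hd; destruct Hd as [v Hv]; now exists f, v.
Qed.

Lemma is_lim_seq_inv_INR (m : R) : is_lim_seq (fun k => m - / (INR k + 1)) m.
Proof.
  replace (Finite m) with (Finite (m - 0)) by (f_equal; ring).
  apply is_lim_seq_minus'; [apply is_lim_seq_const|].
  apply (is_lim_seq_ext (fun k => / INR (S k))); [intros; now rewrite S_INR|].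
  apply (is_lim_seq_inv (fun k => INR (S k)) p_infty);
    [|discriminate].
  apply -> is_lim_seq_incr_1; apply is_lim_seq_INR.
Qed.

(** Compactness is expressed through the values of [G], so [T] carries no topology. If [G] were
    unbounded above, points with G > k would have a subsequence along which [G] both converges and
    tends to infinity. *)
Lemma seq_compact_max {T : Type} (K : T -> Prop) (G : T -> R) :
  (exists x, K x) ->
  (forall x : nat -> T, (forall k, K (x k)) -> exists f y, extractor f /\ K y /\
     is_lim_seq (fun k => G (x (f k))) (G y)) ->
  exists y, K y /\ forall x, K x -> G x <= G y.
Proof.
  intros [x0 Hx0] HK.
  assert (Hb : bound (fun z => exists x, K x /\ z = G x)).
  { apply NNPP; intros H.
    assert (Hk : forall k, exists x, K x /\ INR k < G x).
    { intros k; apply NNPP; intros Hk; apply H; exists (INR k); intros z [x [Hx ->]].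
      apply Rnot_lt_le; intros L; apply Hk; now exists x. }
    apply choice in Hk; destruct Hk as [x Hx].
    destruct (HK x (fun k => proj1 (Hx k))) as [f [y [Hf [_ L]]]].
    assert (L' : is_lim_seq (fun k => G (x (f k))) p_infty).
    { apply (is_lim_seq_le_p_loc INR); [|apply is_lim_seq_INR].
      exists O; intros k _; generalize (proj2 (Hx (f k))).
      generalize (le_INR _ _ (extractor_ge f Hf k)); lra. }
    apply is_lim_seq_unique in L; apply is_lim_seq_unique in L'.
    rewrite L in L'; discriminate. }
  destruct (completeness _ Hb) as [m [Hm1 Hm2]]; [now exists (G x0), x0|].
  assert (Hk : forall k, exists x, K x /\ m - / (INR k + 1) < G x).
  { intros k; apply NNPP; intros Hk.
    assert (e : 0 < / (INR k + 1)) by (apply Rinv_0_lt_compat; generalize (pos_INR k); lra).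
    assert (m <= m - / (INR k + 1)); [|lra].
    apply Hm2; intros z [x [Hx ->]]; apply Rnot_lt_le; intros L; apply Hk; now exists x. }
  apply choice in Hk; destruct Hk as [x Hx].
  destruct (HK x (fun k => proj1 (Hx k))) as [f [y [Hf [Hy L]]]].
  exists y; split; [exact Hy|]; intros z Hz.
  apply Rle_trans with m; [apply Hm1; now exists z|].
  apply (is_lim_seq_le (fun k => m - / (INR (f k) + 1)) _ m (G y)
           (fun k => Rlt_le _ _ (proj2 (Hx (f k))))); [|exact L].
  apply (is_lim_seq_extract (fun k => m - / (INR k + 1)) m f Hf), is_lim_seq_inv_INR.
Qed.

(** * The energy along fibers *)

Implicit Types (u v : Z -> R) (n m : Z).

Definition theta (s t : R) (u : Z -> R) (n : Z) : R := s * posp u n + t * negp u n.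

Lemma posp_negp u n : posp u n + negp u n = u n.
Proof. unfold posp, negp, Rmax, Rmin; destruct (Rle_dec (u n) 0); lra. Qed.

Lemma parts_cases u n :
  (0 < u n /\ posp u n = u n /\ negp u n = 0) \/ (u n <= 0 /\ posp u n = 0 /\ negp u n = u n).
Proof. unfold posp, negp, Rmax, Rmin; destruct (Rle_dec (u n) 0); [right | left]; lra. Qed.

(** Both x -> max(x, 0) and x -> min(x, 0) are nondecreasing, so neither increment has the sign
    opposite to that of [Delta u n]. *)
Lemma Delta_parts_same_sign u n : 0 <= Delta (posp u) n * Delta (negp u) n.
Proof.
  unfold Delta.
  destruct (parts_cases u n) as [[? [-> ->]]|[? [-> ->]]],
    (parts_cases u (n + 1)) as [[? [-> ->]]|[? [-> ->]]]; nra.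
Qed.

Lemma Delta_plus u v n : Delta (fun m => u m + v m) n = Delta u n + Delta v n.
Proof. unfold Delta; ring. Qed.

Lemma Delta_parts u n : Delta (posp u) n + Delta (negp u) n = Delta u n.
Proof.
  unfold Delta; rewrite <- (posp_negp u n), <- (posp_negp u (n + 1)); ring.
Qed.

Lemma Delta_theta s t u n : Delta (theta s t u) n = s * Delta (posp u) n + t * Delta (negp u) n.
Proof. unfold Delta, theta; ring. Qed.

Lemma theta_1 u : theta 1 1 u = u.
Proof.
  apply functional_extensionality; intros n; unfold theta; generalize (posp_negp u n); lra.
Qed.

Lemma posp_theta s t u n : 0 <= s -> 0 <= t -> posp (theta s t u) n = s * posp u n.
Proof.
  intros Hs Ht; unfold theta; unfold posp at 1.
  destruct (parts_cases u n) as [[? [-> ->]]|[? [-> ->]]].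
  - rewrite Rmax_left; nra.
  - rewrite Rmax_right; nra.
Qed.

Lemma negp_theta s t u n : 0 <= s -> 0 <= t -> negp (theta s t u) n = t * negp u n.
Proof.
  intros Hs Ht; unfold theta; unfold negp at 1.
  destruct (parts_cases u n) as [[? [-> ->]]|[? [-> ->]]].
  - rewrite Rmin_right; nra.
  - rewrite Rmin_left; nra.
Qed.

Lemma theta_theta s t s' t' u : 0 <= s -> 0 <= t ->
  theta s' t' (theta s t u) = theta (s' * s) (t' * t) u.
Proof.
  intros Hs Ht; apply functional_extensionality; intros n; unfold theta at 1.
  rewrite posp_theta, negp_theta by assumption; unfold theta; ring.
Qed.

Lemma posp_neq0 u : posp u <> (fun _ => 0) <-> exists n, 0 < u n.
Proof.
  split.
  - intros H; apply NNPP; intros H'; apply H, functional_extensionality; intros n.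
    apply Rmax_right, Rnot_lt_le; intros Hn; apply H'; now exists n.
  - intros [n Hn] H; assert (E := f_equal (fun f => f n) H); simpl in E.
    unfold posp in E; rewrite Rmax_left in E; lra.
Qed.

Lemma negp_neq0 u : negp u <> (fun _ => 0) <-> exists n, u n < 0.
Proof.
  split.
  - intros H; apply NNPP; intros H'; apply H, functional_extensionality; intros n.
    apply Rmin_right, Rnot_lt_le; intros Hn; apply H'; now exists n.
  - intros [n Hn] H; assert (E := f_equal (fun f => f n) H); simpl in E.
    unfold negp in E; rewrite Rmin_left in E; lra.
Qed.

Section Variational.
Context (p q r : R) (a b c : Z -> R) (b0 : R).
Context (Hp : 1 < p) (Hpq : p < q) (Hr : 0 < r).
Context (Ha : forall n, 0 < a n) (Hb0 : 0 < b0) (Hb : forall n, b0 <= b n).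
Context (Hc : forall n, 0 < c n) (Hcs : zsummable c).

Let E := inE p a b.
Let N := normp p a b.

Definition Sc (u : Z -> R) : R := zsum (fun n => c n * rpow (Rabs (u n)) q).
(** A product instead of a case distinction: the factor |u n|^q vanishes at a zero entry, in
    agreement with [logterm]. The exponent r of the logarithm is pulled out as a factor. *)
Definition Sl (u : Z -> R) : R :=
  zsum (fun n => c n * (rpow (Rabs (u n)) q * ln (Rabs (u n)))).
Definition Nterm (u v : Z -> R) (n : Z) : R :=
  a n * (phi p (Delta u n) * Delta v n) + b n * (phi p (u n) * v n).
Definition Nd (u v : Z -> R) : R := zsum (Nterm u v).
Definition Ld (u v : Z -> R) : R :=
  zsum (fun n => c n * (phi q (u n) * ln (Rabs (u n)) * v n)).

Lemma logterm_eq u n :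
  logterm q r c u n = r * (c n * (rpow (Rabs (u n)) q * ln (Rabs (u n)))).
Proof.
  unfold logterm; destruct (Req_EM_T (u n) 0) as [->|H].
  - rewrite Rabs_R0, rpow_0; ring.
  - rewrite ln_rpow by now apply Rabs_no_R0. ring.
Qed.

Lemma I_eq u : I p q r a b c u = 1 / p * N u + r / q ^ 2 * Sc u - r / q * Sl u.
Proof.
  unfold I; rewrite (zsum_ext _ _ (logterm_eq u)), zsum_scal.
  change (zsum _) with (Sc u) at 1; change (zsum _) with (Sl u) at 1; unfold N.
  unfold Rdiv; ring.
Qed.

Lemma dI_eq u v : dI p q r a b c u v = Nd u v - r * Ld u v.
Proof.
  unfold dI, Nd, Ld; f_equal.
  - apply zsum_ext; intros n; unfold Nterm, phi; ring.
  - rewrite <- zsum_scal; apply zsum_ext; intros n.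
    destruct (Req_EM_T (u n) 0) as [->|H]; [rewrite phi_0; ring|].
    rewrite ln_rpow by (now apply Rabs_no_R0). unfold phi; ring.
Qed.

Let bpos n : 0 < b n. Proof. generalize (Hb n); lra. Qed.

Lemma normterm_ge0 u n : 0 <= normterm p a b u n.
Proof.
  unfold normterm; apply Rplus_le_le_0_compat;
    (apply Rmult_le_pos; [apply Rlt_le; auto | apply rpow_ge0]).
Qed.

Lemma N_ge0 u : E u -> 0 <= N u.
Proof. intros H; apply zsum_ge0; [apply normterm_ge0 | exact H]. Qed.

Lemma inE_site_bound u n : E u -> b n * rpow (Rabs (u n)) p <= N u.
Proof.
  intros H; assert (T := zsum_ge_term _ n (normterm_ge0 u) H).
  unfold N, normp; unfold normterm in T at 1.
  assert (0 <= a n * rpow (Rabs (Delta u n)) p); [|lra].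
  apply Rmult_le_pos; [apply Rlt_le; auto | apply rpow_ge0].
Qed.

(** The bound depends on [u] only through [K], so along a sequence bounded in [E] a single multiple
    of c dominates all logarithmic sums. *)
Lemma inE_bound u K n : E u -> N u <= K -> Rabs (u n) <= rpow (K / b0) (/ p).
Proof.
  intros H HK; assert (B := inE_site_bound u n H).
  assert (X := rpow_ge0 (Rabs (u n)) p); specialize (Hb n).
  rewrite <- (rpow_x1 (Rabs (u n))) by apply Rabs_pos.
  replace 1 with (p * / p) by (field; lra); rewrite <- rpow_rpow.
  apply rpow_le; [left; apply Rinv_0_lt_compat; lra|]; split; [assumption|].
  apply Rmult_le_reg_l with b0; [assumption|].
  replace (b0 * (K / b0)) with K by (field; lra); nra.
Qed.

Lemma inE_bounded u : E u -> exists M, forall n, Rabs (u n) <= M.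
Proof.
  intros H; exists (rpow (N u / b0) (/ p)); intros n; apply inE_bound; [assumption | lra].
Qed.

Lemma zsummable_c_bounded (f : Z -> R) K :
  (forall n, Rabs (f n) <= K) -> zsummable (fun n => c n * f n).
Proof.
  intros H; apply (zsummable_le _ (fun n => K * c n)); [|now apply zsummable_scal].
  intros n; rewrite Rabs_mult, (Rabs_pos_eq (c n)) by (apply Rlt_le; auto).
  generalize (Hc n) (H n); nra.
Qed.

Lemma rpow_bounded M : exists K, 0 < K /\ forall x, Rabs x <= M ->
  Rabs (rpow (Rabs x) q) <= K.
Proof.
  apply (continuous_bounded (fun x => rpow (Rabs x) q)); intros x.
  eapply is_derive_continuous, is_derive_rpow; lra.
Qed.

Lemma rpow_ln_bounded M : exists K, 0 < K /\ forall x, Rabs x <= M ->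
  Rabs (rpow (Rabs x) q * ln (Rabs x)) <= K.
Proof.
  apply (continuous_bounded (fun x => rpow (Rabs x) q * ln (Rabs x))); intros x.
  eapply is_derive_continuous, is_derive_rpow_ln; lra.
Qed.

Lemma phi_ln_bounded M : exists K, 0 < K /\ forall x, Rabs x <= M ->
  Rabs (phi q x * ln (Rabs x)) <= K.
Proof.
  apply (continuous_bounded (fun x => phi q x * ln (Rabs x))); intros x.
  apply continuous_phi_ln; lra.
Qed.

Section Bounded.
Context (u : Z -> R) (M : R).
Context (HM : forall n, Rabs (u n) <= M).

Lemma zsummable_Sc : zsummable (fun n => c n * rpow (Rabs (u n)) q).
Proof.
  destruct (rpow_bounded M) as [K [_ HK]].
  apply (zsummable_c_bounded _ K); intros n; apply HK, HM.
Qed.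

Lemma zsummable_Sl : zsummable (fun n => c n * (rpow (Rabs (u n)) q * ln (Rabs (u n)))).
Proof.
  destruct (rpow_ln_bounded M) as [K [_ HK]].
  apply (zsummable_c_bounded _ K); intros n; apply HK, HM.
Qed.

Lemma zsummable_Ld v M' : (forall n, Rabs (v n) <= M') ->
  zsummable (fun n => c n * (phi q (u n) * ln (Rabs (u n)) * v n)).
Proof.
  intros HM'; destruct (phi_ln_bounded M) as [K [_ HK]].
  apply (zsummable_c_bounded _ (K * M')); intros n; rewrite Rabs_mult.
  apply Rmult_le_compat; try apply Rabs_pos; [apply HK, HM | apply HM'].
Qed.
End Bounded.

(** Sequences in [E] are bounded, |x|^q ln|x| is bounded on bounded sets and c is summable, so the
    logarithmic series converges absolutely. *)
Lemma inD_inE u : inD p q r a b c u <-> E u.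
Proof.
  split; [intros H; apply H|]; intros H; split; [exact H|].
  destruct (inE_bounded u H) as [M HM].
  apply (zsummable_le _ (fun n => Rabs (r * (c n * (rpow (Rabs (u n)) q * ln (Rabs (u n))))))).
  - intros n; rewrite <- logterm_eq; unfold Rmax; destruct (Rle_dec 0 _); [lra|].
    rewrite Rabs_R0; apply Rabs_pos.
  - apply (zsummable_ext (fun n =>
      r * (c n * Rabs (rpow (Rabs (u n)) q * ln (Rabs (u n)))))).
    + intros n; rewrite !Rabs_mult, (Rabs_pos_eq r), (Rabs_pos_eq (c n));
        [reflexivity | apply Rlt_le, Hc | lra].
    + apply zsummable_scal; destruct (rpow_ln_bounded M) as [K [_ HK]].
      apply (zsummable_c_bounded _ K); intros n; rewrite Rabs_Rabsolu; apply HK, HM.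
Qed.

Lemma Nterm_le u v n : Rabs (Nterm u v n) <= normterm p a b u n + normterm p a b v n.
Proof.
  unfold Nterm, normterm.
  assert (A1 := Rabs_le_pow_sum (Delta u n) (Delta v n) p Hp).
  assert (A2 := Rabs_le_pow_sum (u n) (v n) p Hp).
  eapply Rle_trans; [apply Rabs_triang|].
  rewrite !(Rabs_mult (_ n)), (Rabs_pos_eq (a n)), (Rabs_pos_eq (b n))
    by (apply Rlt_le; auto).
  unfold phi; generalize (Ha n) (bpos n); nra.
Qed.

Lemma zsummable_Nterm u v : E u -> E v -> zsummable (Nterm u v).
Proof.
  intros Hu Hv; eapply zsummable_le; [apply Nterm_le|]; now apply zsummable_plus.
Qed.

Lemma normterm_dominated u v K n : 0 <= K ->
  Rabs (v n) <= K * Rabs (u n) -> Rabs (Delta v n) <= K * Rabs (Delta u n) ->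
  normterm p a b v n <= rpow K p * normterm p a b u n.
Proof.
  intros HK H1 H2; unfold normterm.
  assert (A1 : rpow (Rabs (v n)) p <= rpow K p * rpow (Rabs (u n)) p).
  { rewrite <- rpow_mult by (assumption || apply Rabs_pos).
    apply rpow_le; [lra|]; split; [apply Rabs_pos | apply H1]. }
  assert (A2 : rpow (Rabs (Delta v n)) p <= rpow K p * rpow (Rabs (Delta u n)) p).
  { rewrite <- rpow_mult by (assumption || apply Rabs_pos).
    apply rpow_le; [lra|]; split; [apply Rabs_pos | apply H2]. }
  generalize (Ha n) (bpos n); nra.
Qed.

(** Domination of the entries alone would not do when [a] is unbounded, hence the condition on the
    differences. Fibers, sign components and soft thresholds satisfy both conditions. *)
Lemma inE_dominated u v K : E u -> 0 <= K ->
  (forall n, Rabs (v n) <= K * Rabs (u n)) ->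
  (forall n, Rabs (Delta v n) <= K * Rabs (Delta u n)) -> E v.
Proof.
  intros Hu HK H1 H2; apply (zsummable_le _ (fun n => rpow K p * normterm p a b u n));
    [|now apply zsummable_scal].
  intros n; rewrite Rabs_pos_eq by apply normterm_ge0; now apply normterm_dominated.
Qed.

Lemma inE_plus u v : E u -> E v -> E (fun n => u n + v n).
Proof.
  intros Hu Hv.
  apply (zsummable_le _ (fun n => rpow 2 p * (normterm p a b u n + normterm p a b v n)));
    [|now apply zsummable_scal, zsummable_plus].
  intros n; rewrite Rabs_pos_eq by apply normterm_ge0; unfold normterm; rewrite Delta_plus.
  assert (A1 := rpow_Rabs_plus (u n) (v n) p ltac:(lra)).
  assert (A2 := rpow_Rabs_plus (Delta u n) (Delta v n) p ltac:(lra)).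
  generalize (Ha n) (bpos n); nra.
Qed.

Lemma inE_scal x u : E u -> E (fun n => x * u n).
Proof.
  intros Hu; apply (inE_dominated u _ (Rabs x) Hu); [apply Rabs_pos | |]; intros n.
  - rewrite Rabs_mult; lra.
  - rewrite <- Rabs_mult; unfold Delta; apply Req_le; f_equal; ring.
Qed.

Lemma Delta_unit_0 n m : m <> (n - 1)%Z -> m <> n -> Delta (zunit n) m = 0.
Proof.
  intros H1 H2; unfold Delta, zunit.
  destruct (Z.eq_dec (m + 1) n), (Z.eq_dec m n); try lia; ring.
Qed.

Lemma zunit_0 n m : m <> n -> zunit n m = 0.
Proof. intros H; unfold zunit; destruct (Z.eq_dec m n); [contradiction | reflexivity]. Qed.

Lemma inE_unit n : E (zunit n).
Proof.
  apply (zsummable_two _ n); intros m H1 H2; unfold normterm.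
  rewrite Delta_unit_0, zunit_0, Rabs_R0, rpow_0 by assumption; ring.
Qed.

Lemma theta_abs s t u n : 0 <= s -> 0 <= t ->
  Rabs (theta s t u n) <= Rmax s t * Rabs (u n).
Proof.
  intros Hs Ht; assert (s <= Rmax s t) by apply Rmax_l; assert (t <= Rmax s t) by apply Rmax_r.
  unfold theta; destruct (parts_cases u n) as [[? [-> ->]]|[? [-> ->]]].
  - rewrite Rmult_0_r, Rplus_0_r, Rabs_mult, (Rabs_pos_eq s) by assumption.
    generalize (Rabs_pos (u n)); nra.
  - rewrite Rmult_0_r, Rplus_0_l, Rabs_mult, (Rabs_pos_eq t) by assumption.
    generalize (Rabs_pos (u n)); nra.
Qed.

(** For A and B of the same sign, |s A + t B| <= max(s, t) (|A| + |B|) = max(s, t) |A + B|. *)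
Lemma Delta_theta_abs s t u n : 0 <= s -> 0 <= t ->
  Rabs (Delta (theta s t u) n) <= Rmax s t * Rabs (Delta u n).
Proof.
  intros Hs Ht; assert (s <= Rmax s t) by apply Rmax_l; assert (t <= Rmax s t) by apply Rmax_r.
  rewrite Delta_theta, <- (Delta_parts u n).
  assert (S := Delta_parts_same_sign u n).
  rewrite (Rabs_plus_same_sign (Delta (posp u) n) _ S).
  eapply Rle_trans; [apply Rabs_triang|]; rewrite !Rabs_mult, (Rabs_pos_eq s), (Rabs_pos_eq t)
    by assumption.
  generalize (Rabs_pos (Delta (posp u) n)) (Rabs_pos (Delta (negp u) n)); nra.
Qed.

Lemma inE_theta s t u : 0 <= s -> 0 <= t -> E u -> E (theta s t u).
Proof.
  intros Hs Ht Hu; apply (inE_dominated u _ (Rmax s t) Hu).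
  - eapply Rle_trans; [apply Hs | apply Rmax_l].
  - intros; now apply theta_abs.
  - intros; now apply Delta_theta_abs.
Qed.

Lemma theta_10 u : theta 1 0 u = posp u.
Proof. apply functional_extensionality; intros n; unfold theta; ring. Qed.

Lemma theta_01 u : theta 0 1 u = negp u.
Proof. apply functional_extensionality; intros n; unfold theta; ring. Qed.

Lemma inE_posp u : E u -> E (posp u).
Proof. rewrite <- theta_10; apply inE_theta; lra. Qed.

Lemma inE_negp u : E u -> E (negp u).
Proof. rewrite <- theta_01; apply inE_theta; lra. Qed.

Lemma Sc_ge0 u : E u -> 0 <= Sc u.
Proof.
  intros Hu; destruct (inE_bounded u Hu) as [M HM].
  apply zsum_ge0; [|now apply (zsummable_Sc u M)].
  intros n; apply Rmult_le_pos; [apply Rlt_le, Hc | apply rpow_ge0].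
Qed.

Lemma Sc_gt0 u : E u -> (exists n, u n <> 0) -> 0 < Sc u.
Proof.
  intros Hu [n Hn]; destruct (inE_bounded u Hu) as [M HM].
  apply zsum_gt0; [| |now apply (zsummable_Sc u M)].
  - intros m; apply Rmult_le_pos; [apply Rlt_le, Hc | apply rpow_ge0].
  - exists n; apply Rmult_lt_0_compat; [apply Hc | now apply rpow_gt0, Rabs_no_R0].
Qed.

Lemma N_gt0 u : E u -> (exists n, u n <> 0) -> 0 < N u.
Proof.
  intros Hu [n Hn]; eapply Rlt_le_trans; [|now apply (inE_site_bound u n)].
  apply Rmult_lt_0_compat; [apply bpos | now apply rpow_gt0, Rabs_no_R0].
Qed.

(** * Splitting of the energy on a fiber *)

Lemma rpow_theta s t u n : 0 <= s -> 0 <= t ->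
  rpow (Rabs (theta s t u n)) q
  = rpow s q * rpow (Rabs (posp u n)) q + rpow t q * rpow (Rabs (negp u n)) q.
Proof.
  intros Hs Ht; unfold theta; destruct (parts_cases u n) as [[? [-> ->]]|[? [-> ->]]].
  - rewrite Rmult_0_r, Rplus_0_r, Rabs_mult, (Rabs_pos_eq s), Rabs_R0, rpow_0 by assumption.
    rewrite rpow_mult by (assumption || apply Rabs_pos); ring.
  - rewrite Rmult_0_r, Rplus_0_l, Rabs_mult, (Rabs_pos_eq t), Rabs_R0, rpow_0 by assumption.
    rewrite rpow_mult by (assumption || apply Rabs_pos); ring.
Qed.

Lemma rpow_ln_mult s x : 0 <= s ->
  rpow (Rabs (s * x)) q * ln (Rabs (s * x))
  = rpow s q * (rpow (Rabs x) q * ln (Rabs x) + ln s * rpow (Rabs x) q).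
Proof.
  intros [Hs| <-]; [|rewrite Rmult_0_l, Rabs_R0, !rpow_0; ring].
  destruct (Req_EM_T x 0) as [->|Hx]; [rewrite Rmult_0_r, Rabs_R0, !rpow_0; ring|].
  rewrite Rabs_mult, (Rabs_pos_eq s), rpow_mult, ln_mult
    by (lra || apply Rabs_pos || now apply Rabs_pos_lt).
  ring.
Qed.

Lemma rpow_ln_theta s t u n : 0 <= s -> 0 <= t ->
  rpow (Rabs (theta s t u n)) q * ln (Rabs (theta s t u n))
  = rpow s q * (rpow (Rabs (posp u n)) q * ln (Rabs (posp u n))
                + ln s * rpow (Rabs (posp u n)) q)
  + rpow t q * (rpow (Rabs (negp u n)) q * ln (Rabs (negp u n))
                + ln t * rpow (Rabs (negp u n)) q).
Proof.
  intros Hs Ht; unfold theta; destruct (parts_cases u n) as [[? [-> ->]]|[? [-> ->]]].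
  - rewrite Rmult_0_r, Rplus_0_r, rpow_ln_mult, Rabs_R0, rpow_0 by assumption; ring.
  - rewrite Rmult_0_r, Rplus_0_l, rpow_ln_mult, Rabs_R0, rpow_0 by assumption; ring.
Qed.

Lemma Sc_theta s t u : 0 <= s -> 0 <= t -> E u ->
  Sc (theta s t u) = rpow s q * Sc (posp u) + rpow t q * Sc (negp u).
Proof.
  intros Hs Ht Hu; unfold Sc; rewrite <- !zsum_scal.
  destruct (inE_bounded _ (inE_posp u Hu)) as [M1 H1].
  destruct (inE_bounded _ (inE_negp u Hu)) as [M2 H2].
  rewrite <- zsum_plus.
  - apply zsum_ext; intros n; rewrite rpow_theta by assumption; ring.
  - now apply zsummable_scal, (zsummable_Sc _ M1).
  - now apply zsummable_scal, (zsummable_Sc _ M2).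
Qed.

Lemma Sl_theta s t u : 0 <= s -> 0 <= t -> E u ->
  Sl (theta s t u) = rpow s q * (Sl (posp u) + ln s * Sc (posp u))
                   + rpow t q * (Sl (negp u) + ln t * Sc (negp u)).
Proof.
  intros Hs Ht Hu; unfold Sl, Sc; rewrite <- !zsum_scal.
  destruct (inE_bounded _ (inE_posp u Hu)) as [M1 H1].
  destruct (inE_bounded _ (inE_negp u Hu)) as [M2 H2].
  assert (X1 := zsummable_Sc _ M1 H1); assert (X2 := zsummable_Sl _ M1 H1).
  assert (Y1 := zsummable_Sc _ M2 H2); assert (Y2 := zsummable_Sl _ M2 H2).
  rewrite <- !zsum_plus, <- !zsum_scal, <- zsum_plus;
    repeat (assumption || apply zsummable_plus || apply zsummable_scal).
  apply zsum_ext; intros n; rewrite rpow_ln_theta by assumption; ring.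
Qed.

(** The contribution to the energy, norm excluded, of one sign part scaled by s, where C and B are
    [Sc] and [Sl] of that part. Since u^+ and u^- have disjoint supports, these contributions add up
    on a fiber; only the norm couples s and t. *)
Definition fiber_log (C B s : R) : R := rpow s q * (r / q ^ 2 * C - r / q * (B + ln s * C)).

Lemma I_theta s t u : 0 <= s -> 0 <= t -> E u ->
  I p q r a b c (theta s t u)
  = 1 / p * N (theta s t u) + fiber_log (Sc (posp u)) (Sl (posp u)) s
    + fiber_log (Sc (negp u)) (Sl (negp u)) t.
Proof.
  intros Hs Ht Hu; rewrite I_eq, Sc_theta, Sl_theta by assumption; unfold fiber_log; ring.
Qed.

(** Where a piece of [u] does not vanish it equals [u], so its logarithmic pairing depends on the
    piece alone and ignores the deletion of other pieces. *)
Lemma Ld_restrict u v : (forall n, v n = u n \/ v n = 0) -> Ld u v = Sl v.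
Proof.
  intros H; apply zsum_ext; intros n; f_equal; destruct (H n) as [-> | ->].
  - rewrite <- phi_mult_self; ring.
  - rewrite Rabs_R0, rpow_0; ring.
Qed.

Lemma Ld_posp u : Ld u (posp u) = Sl (posp u).
Proof.
  apply Ld_restrict; intros n; destruct (parts_cases u n) as [[_ [-> _]]|[_ [-> _]]]; auto.
Qed.

Lemma Ld_negp u : Ld u (negp u) = Sl (negp u).
Proof.
  apply Ld_restrict; intros n; destruct (parts_cases u n) as [[_ [_ ->]]|[_ [_ ->]]]; auto.
Qed.

Lemma dI_posp u : dI p q r a b c u (posp u) = Nd u (posp u) - r * Sl (posp u).
Proof. now rewrite dI_eq, Ld_posp. Qed.

Lemma dI_negp u : dI p q r a b c u (negp u) = Nd u (negp u) - r * Sl (negp u).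
Proof. now rewrite dI_eq, Ld_negp. Qed.

Lemma norm_fibering s t u : 0 <= s -> 0 <= t -> E u ->
  (1 - rpow s q) / q * Nd u (posp u) + (1 - rpow t q) / q * Nd u (negp u)
  <= 1 / p * (N u - N (theta s t u)).
Proof.
  intros Hs Ht Hu; unfold Nd, N, normp.
  assert (X1 := zsummable_Nterm u _ Hu (inE_posp u Hu)).
  assert (X2 := zsummable_Nterm u _ Hu (inE_negp u Hu)).
  assert (Y := inE_theta s t u Hs Ht Hu).
  rewrite <- zsum_minus, <- !zsum_scal, <- zsum_plus by
    (assumption || now apply zsummable_scal).
  apply zsum_le;
    [|now apply zsummable_plus; apply zsummable_scal
     |now apply zsummable_scal, zsummable_minus].
  intros n; unfold Nterm, normterm.
  assert (F1 := rpow_fibering p q (Delta (posp u) n) (Delta (negp u) n) s t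
    Hp Hpq Hs Ht (Delta_parts_same_sign u n)).
  assert (F2 := rpow_fibering p q (posp u n) (negp u n) s t Hp Hpq Hs Ht).
  rewrite Delta_parts, <- Delta_theta in F1; rewrite posp_negp in F2.
  change (s * posp u n + t * negp u n) with (theta s t u n) in F2.
  assert (0 <= posp u n * negp u n)
    by (destruct (parts_cases u n) as [[_ [_ ->]]|[_ [-> _]]]; lra).
  specialize (F2 H).
  apply (Rmult_le_compat_l _ _ _ (Rlt_le _ _ (Ha n))) in F1.
  apply (Rmult_le_compat_l _ _ _ (Rlt_le _ _ (bpos n))) in F2.
  lra.
Qed.

(** Convexity of |x|^p, summed over sites and differences. It takes the place of differentiating the
    infinite sum [N (theta s t u)] in s and t. *)
Lemma norm_tangent s t u : 0 <= s -> 0 <= t -> E u ->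
  1 / p * N u + (s - 1) * Nd u (posp u) + (t - 1) * Nd u (negp u)
  <= 1 / p * N (theta s t u).
Proof.
  intros Hs Ht Hu; unfold Nd, N, normp.
  assert (X1 := zsummable_Nterm u _ Hu (inE_posp u Hu)).
  assert (X2 := zsummable_Nterm u _ Hu (inE_negp u Hu)).
  assert (Y := inE_theta s t u Hs Ht Hu).
  rewrite <- !zsum_scal, <- !zsum_plus
    by (repeat (assumption || apply zsummable_plus || apply zsummable_scal)).
  apply zsum_le; try (repeat (assumption || apply zsummable_plus || apply zsummable_scal)).
  intros n; unfold Nterm, normterm.
  assert (F1 := rpow_tangent p (Delta u n) (Delta (theta s t u) n) Hp).
  assert (F2 := rpow_tangent p (u n) (theta s t u n) Hp).
  apply (Rmult_le_compat_l (a n / p)) in F1;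
    [|apply Rlt_le, Rdiv_lt_0_compat; [apply Ha | lra]].
  apply (Rmult_le_compat_l (b n / p)) in F2;
    [|apply Rlt_le, Rdiv_lt_0_compat; [apply bpos | lra]].
  replace (Delta (theta s t u) n - Delta u n)
    with ((s - 1) * Delta (posp u) n + (t - 1) * Delta (negp u) n) in F1
    by (rewrite Delta_theta, <- (Delta_parts u n); ring).
  replace (theta s t u n - u n) with ((s - 1) * posp u n + (t - 1) * negp u n) in F2
    by (unfold theta; rewrite <- (posp_negp u n); ring).
  eapply Rle_trans; [|eapply Rle_trans; [apply (Rplus_le_compat _ _ _ _ F1 F2)|]];
    apply Req_le; field; lra.
Qed.

(** The inequality comes from [norm_fibering]; the logarithmic part is an identity. Its last summand
    is the defect, built from h(x) = 1 - x + x ln x at x = s^q and x = t^q, which is nonnegative and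
    vanishes only at x = 1. *)
Lemma I_fibering s t u : 0 <= s -> 0 <= t -> E u ->
  I p q r a b c (theta s t u)
  + (1 - rpow s q) / q * dI p q r a b c u (posp u)
  + (1 - rpow t q) / q * dI p q r a b c u (negp u)
  + r / q ^ 2 * (Sc (posp u) * (1 - rpow s q + rpow s q * ln (rpow s q))
                 + Sc (negp u) * (1 - rpow t q + rpow t q * ln (rpow t q)))
  <= I p q r a b c u.
Proof.
  intros Hs Ht Hu; assert (F := norm_fibering s t u Hs Ht Hu).
  assert (I1 := I_theta 1 1 u ltac:(lra) ltac:(lra) Hu); rewrite theta_1 in I1.
  rewrite I1, I_theta, dI_posp, dI_negp by assumption.
  unfold fiber_log; rewrite rpow_1, ln_1.
  assert (L : forall x, 0 <= x -> rpow x q * ln (rpow x q) = q * (rpow x q * ln x)).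
  { intros x [Hx| <-]; [rewrite ln_rpow by lra; ring | rewrite rpow_0; ring]. }
  rewrite !L by assumption.
  apply Rminus_le_0; apply Rminus_le_0 in F.
  eapply Rle_trans; [apply F|]; apply Req_le; field; lra.
Qed.

(** The factor 1/q makes the logarithmic sums cancel; both remaining terms are nonnegative. *)
Lemma I_minus_dI u : E u ->
  I p q r a b c u - 1 / q * (dI p q r a b c u (posp u) + dI p q r a b c u (negp u))
  = (1 / p - 1 / q) * N u + r / q ^ 2 * Sc u.
Proof.
  intros Hu; rewrite dI_posp, dI_negp, I_eq.
  assert (S := Sl_theta 1 1 u ltac:(lra) ltac:(lra) Hu).
  rewrite theta_1, rpow_1, ln_1 in S; rewrite S.
  assert (EN : N u = Nd u (posp u) + Nd u (negp u)).
  { unfold Nd; rewrite <- zsum_plus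
      by (apply zsummable_Nterm; auto using inE_posp, inE_negp).
    apply zsum_ext; intros n; unfold Nterm, normterm.
    rewrite <- !phi_mult_self.
    rewrite <- (Delta_parts u n) at 2; rewrite <- (posp_negp u n) at 2; ring. }
  rewrite EN; field; lra.
Qed.

Let h0 x : 0 <= x -> 0 <= 1 - x + x * ln x.
Proof. intros H; generalize (xlnx_ge x H); lra. Qed.

Let rq : 0 < r / q ^ 2.
Proof. apply Rdiv_lt_0_compat; [assumption | apply pow_lt; lra]. Qed.

Lemma I_M_max s t u : 0 <= s -> 0 <= t -> inM p q r a b c u ->
  I p q r a b c (theta s t u) <= I p q r a b c u.
Proof.
  intros Hs Ht [Hu%inD_inE [_ [_ [H1 H2]]]].
  assert (F := I_fibering s t u Hs Ht Hu); rewrite H1, H2 in F.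
  assert (C1 := Sc_ge0 _ (inE_posp u Hu)); assert (C2 := Sc_ge0 _ (inE_negp u Hu)).
  generalize (h0 (rpow s q) (rpow_ge0 _ _)) (h0 (rpow t q) (rpow_ge0 _ _)); intros.
  assert (0 <= r / q ^ 2 * (Sc (posp u) * (1 - rpow s q + rpow s q * ln (rpow s q))
                 + Sc (negp u) * (1 - rpow t q + rpow t q * ln (rpow t q)))); [|lra].
  apply Rmult_le_pos; [lra|]; apply Rplus_le_le_0_compat; now apply Rmult_le_pos.
Qed.

(** Gives both the positivity of the minimum and the bound on minimizing sequences in [E]. *)
Lemma I_M_lower u : inM p q r a b c u -> (1 / p - 1 / q) * N u < I p q r a b c u.
Proof.
  intros [Hu%inD_inE [[n Hn]%posp_neq0 [_ [H1 H2]]]].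
  assert (F := I_minus_dI u Hu); rewrite H1, H2 in F.
  assert (0 < r / q ^ 2 * Sc u); [|lra].
  apply Rmult_lt_0_compat; [apply rq|]; apply Sc_gt0; [assumption | exists n; lra].
Qed.

Lemma inv_pq : 0 < 1 / p - 1 / q.
Proof.
  replace (1 / p - 1 / q) with ((q - p) / (p * q)) by (field; lra).
  apply Rdiv_lt_0_compat; nra.
Qed.

(** * Continuity and maxima along a fiber *)

Lemma is_lim_normterm (x : nat -> Z -> R) u n :
  (forall m, is_lim_seq (fun k => x k m) (u m)) ->
  is_lim_seq (fun k => normterm p a b (x k) n) (normterm p a b u n).
Proof.
  intros H; unfold normterm.
  apply (is_lim_seq_plus' (fun k => a n * rpow (Rabs (Delta (x k) n)) p)
                          (fun k => b n * rpow (Rabs (x k n)) p));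
    apply (is_lim_seq_scal_l _ _ (Finite _)), is_lim_seq_rpow; try assumption.
  - apply is_lim_seq_minus'; apply H.
  - apply H.
Qed.

Lemma is_lim_theta (s t : nat -> R) (s0 t0 : R) (x : nat -> Z -> R) u n :
  is_lim_seq s s0 -> is_lim_seq t t0 -> is_lim_seq (fun k => x k n) (u n) ->
  is_lim_seq (fun k => theta (s k) (t k) (x k) n) (theta s0 t0 u n).
Proof.
  intros Hs Ht Hx; unfold theta, posp, negp.
  apply is_lim_seq_plus'; (apply is_lim_seq_mult'; [assumption|]).
  - apply (is_lim_seq_ext (fun k => (x k n + Rabs (x k n)) / 2)).
    { intros k; unfold Rmax, Rabs; destruct (Rle_dec (x k n) 0), (Rcase_abs (x k n)); lra. }
    replace (Rmax (u n) 0) with ((u n + Rabs (u n)) / 2)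
      by (unfold Rmax, Rabs; destruct (Rle_dec (u n) 0), (Rcase_abs (u n)); lra).
    apply (is_lim_seq_scal_r _ (/ 2) (Finite _)), is_lim_seq_plus'; [assumption|].
    now apply (is_lim_seq_abs _ (Finite _)).
  - apply (is_lim_seq_ext (fun k => (x k n - Rabs (x k n)) / 2)).
    { intros k; unfold Rmin, Rabs; destruct (Rle_dec (x k n) 0), (Rcase_abs (x k n)); lra. }
    replace (Rmin (u n) 0) with ((u n - Rabs (u n)) / 2)
      by (unfold Rmin, Rabs; destruct (Rle_dec (u n) 0), (Rcase_abs (u n)); lra).
    apply (is_lim_seq_scal_r _ (/ 2) (Finite _)), is_lim_seq_minus'; [assumption|].
    now apply (is_lim_seq_abs _ (Finite _)).
Qed.

Lemma normterm_theta_le s t K u n : 0 <= s <= K -> 0 <= t <= K ->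
  normterm p a b (theta s t u) n <= rpow K p * normterm p a b u n.
Proof.
  intros Hs Ht; assert (Rmax s t <= K) by (apply Rmax_lub; lra).
  apply normterm_dominated; [lra| |].
  - eapply Rle_trans; [apply theta_abs; lra|]; generalize (Rabs_pos (u n)); nra.
  - eapply Rle_trans; [apply Delta_theta_abs; lra|]; generalize (Rabs_pos (Delta u n)); nra.
Qed.

Lemma is_lim_fiber_log C B (s : nat -> R) (s0 : R) :
  (forall k, 0 <= s k) -> 0 <= s0 -> is_lim_seq s s0 ->
  is_lim_seq (fun k => fiber_log C B (s k)) (fiber_log C B s0).
Proof.
  intros Hk H0 Hs; unfold fiber_log.
  assert (L1 := is_lim_seq_rpow q s s0 ltac:(lra) Hs).
  assert (L2 := is_lim_seq_rpow_ln q s s0 ltac:(lra) Hs).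
  rewrite (Rabs_pos_eq s0) in L1, L2 by assumption.
  (* The logarithm is kept inside the product s^q ln s, which is continuous also at s = 0. *)
  apply (is_lim_seq_ext (fun k => (r / q ^ 2 * C - r / q * B) * rpow (Rabs (s k)) q
     - r / q * C * (rpow (Rabs (s k)) q * ln (Rabs (s k))))).
  { intros k; rewrite (Rabs_pos_eq (s k)) by apply Hk; ring. }
  replace (rpow s0 q * _) with ((r / q ^ 2 * C - r / q * B) * rpow s0 q
     - r / q * C * (rpow s0 q * ln s0)) by ring.
  apply is_lim_seq_minus'; now apply (is_lim_seq_scal_l _ _ (Finite _)).
Qed.

Lemma is_lim_I_theta (s t : nat -> R) (s0 t0 K : R) u : E u ->
  (forall k, 0 <= s k <= K) -> (forall k, 0 <= t k <= K) -> 0 <= s0 -> 0 <= t0 ->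
  is_lim_seq s s0 -> is_lim_seq t t0 ->
  is_lim_seq (fun k => I p q r a b c (theta (s k) (t k) u)) (I p q r a b c (theta s0 t0 u)).
Proof.
  intros Hu Hsk Htk Hs0 Ht0 Hs Ht.
  rewrite I_theta by assumption.
  eapply is_lim_seq_ext; [intros k; symmetry; apply I_theta; [apply Hsk | apply Htk | exact Hu]|].
  apply is_lim_seq_plus'; [apply is_lim_seq_plus'|].
  - apply (is_lim_seq_scal_l _ _ (Finite _)).
    apply (zsum_dominated _ _ (fun n => rpow K p * normterm p a b u n)).
    + intros k n; rewrite Rabs_pos_eq by apply normterm_ge0.
      now apply normterm_theta_le.
    + now apply zsummable_scal.
    + intros n; apply is_lim_normterm; intros m.
      apply (is_lim_theta s t s0 t0 (fun _ => u)); try assumption; apply is_lim_seq_const.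
  - apply is_lim_fiber_log; try assumption; intros; apply Hsk.
  - apply is_lim_fiber_log; try assumption; intros; apply Htk.
Qed.

Lemma rectangle_max s0 s1 t0 t1 u : E u -> 0 <= s0 <= s1 -> 0 <= t0 <= t1 ->
  exists s t, s0 <= s <= s1 /\ t0 <= t <= t1 /\
    forall s' t', s0 <= s' <= s1 -> t0 <= t' <= t1 ->
      I p q r a b c (theta s' t' u) <= I p q r a b c (theta s t u).
Proof.
  intros Hu Hs Ht.
  pose (K := fun x : R * R => s0 <= fst x <= s1 /\ t0 <= snd x <= t1).
  pose (G := fun x : R * R => I p q r a b c (theta (fst x) (snd x) u)).
  destruct (seq_compact_max K G) as [[s t] [[H1 H2] H]].
  - exists (s0, t0); unfold K; simpl; lra.
  - intros x Hx.
    (* The two coordinates form a family indexed by j, with s at j = 0 and t elsewhere, so one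
       extraction serves both. *)
    destruct (diagonal_extraction (fun k j => match j with O => fst (x k) | _ => snd (x k) end))
      as [f [Hf Hl]].
    { intros j; exists (s1 + t1); intros k; destruct (Hx k).
      destruct j; rewrite Rabs_pos_eq; lra. }
    destruct (Hl 0%nat) as [s Ls]; destruct (Hl 1%nat) as [t Lt].
    assert (Bs : s0 <= s <= s1).
    { split.
      - apply (is_lim_seq_le (fun _ => s0) _ s0 s (fun k => proj1 (proj1 (Hx (f k)))));
          [apply is_lim_seq_const | exact Ls].
      - apply (is_lim_seq_le _ (fun _ => s1) s s1 (fun k => proj2 (proj1 (Hx (f k)))));
          [exact Ls | apply is_lim_seq_const]. }
    assert (Bt : t0 <= t <= t1).
    { split.
      - apply (is_lim_seq_le (fun _ => t0) _ t0 t (fun k => proj1 (proj2 (Hx (f k)))));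
          [apply is_lim_seq_const | exact Lt].
      - apply (is_lim_seq_le _ (fun _ => t1) t t1 (fun k => proj2 (proj2 (Hx (f k)))));
          [exact Lt | apply is_lim_seq_const]. }
    exists f, (s, t); split; [exact Hf|]; split; [split; assumption|].
    apply (is_lim_I_theta _ _ _ _ (s1 + t1)); try assumption; simpl; try lra.
    + intros k; destruct (Hx (f k)); lra.
    + intros k; destruct (Hx (f k)); lra.
  - exists s, t; split; [exact H1|]; split; [exact H2|].
    intros s' t' Hs' Ht'; apply (H (s', t')); now split.
Qed.

Lemma fiber_log_0 C B : fiber_log C B 0 = 0.
Proof. unfold fiber_log; rewrite rpow_0; ring. Qed.

(** The function has a local maximum at s = 1, where its derivative is P - r B; the terms in C
    cancel thanks to the coefficient r/q^2 in [I]. *)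
Lemma tangent_fiber_max P C B d : 0 < d ->
  (forall s, 0 <= s -> Rabs (s - 1) < d -> (s - 1) * P + fiber_log C B s <= fiber_log C B 1) ->
  P - r * B = 0.
Proof.
  intros Hd H.
  pose (g := fun s => (s - 1) * P + fiber_log C B s).
  assert (D : is_derive g 1 (P - r * B)).
  { unfold g, fiber_log.
    apply (is_derive_ext_loc (fun s => (s - 1) * P
      + exp (q * ln s) * (r / q ^ 2 * C - r / q * (B + ln s * C)))).
    - exists (mkposreal 1 Rlt_0_1); intros y Hy%Rabs_lt_between'; simpl in Hy.
      rewrite rpow_Rpower by lra; reflexivity.
    - auto_derive; [lra|]; rewrite ln_1, Rmult_0_r, exp_0; field; lra. }
  apply is_derive_Reals in D.
  assert (X := deriv_maximum g (1 - Rmin d 1) (1 + Rmin d 1) 1 (exist _ _ D)).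
  assert (0 < Rmin d 1) by (apply Rmin_pos; lra).
  apply X; try lra.
  intros s Hs1 Hs2; unfold g; rewrite Rminus_diag, Rmult_0_l, Rplus_0_l.
  generalize (Rmin_l d 1) (Rmin_r d 1); intros; apply H; [lra|].
  apply Rabs_def1; lra.
Qed.

(** The maximum persists when the norm is replaced by its affine minorant, with equality at (1, 1).
    With one parameter varied at a time, a one-variable stationarity condition remains. *)
Lemma local_max_inM u d : E u -> (exists n, 0 < u n) -> (exists n, u n < 0) -> 0 < d ->
  (forall s t, 0 <= s -> 0 <= t -> Rabs (s - 1) < d -> Rabs (t - 1) < d ->
    I p q r a b c (theta s t u) <= I p q r a b c u) ->
  inM p q r a b c u.
Proof.
  intros Hu Hu1 Hu2 Hd H; split; [now apply inD_inE|].
  split; [now apply posp_neq0|]; split; [now apply negp_neq0|].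
  assert (I1 := I_theta 1 1 u ltac:(lra) ltac:(lra) Hu); rewrite theta_1 in I1.
  assert (H1 : Rabs (1 - 1) < d) by (rewrite Rminus_diag, Rabs_R0; assumption).
  rewrite dI_posp, dI_negp; split.
  - apply (tangent_fiber_max _ (Sc (posp u)) _ d Hd); intros s Hs Hsd.
    specialize (H s 1 Hs ltac:(lra) Hsd H1).
    assert (T := norm_tangent s 1 u Hs ltac:(lra) Hu).
    rewrite I1, I_theta in H by (assumption || lra); lra.
  - apply (tangent_fiber_max _ (Sc (negp u)) _ d Hd); intros t Ht Htd.
    specialize (H 1 t ltac:(lra) Ht H1 Htd).
    assert (T := norm_tangent 1 t u ltac:(lra) Ht Hu).
    rewrite I1, I_theta in H by (assumption || lra); lra.
Qed.

(** The maximum over the rectangle cannot lie on the boundary, where each point is beaten. Rebased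
    at the maximizer, the fiber has its local maximum at (1, 1). *)
Lemma interior_max_inM s0 s1 t0 t1 u :
  E u -> (exists n, 0 < u n) -> (exists n, u n < 0) -> 0 <= s0 <= s1 -> 0 <= t0 <= t1 ->
  (forall s t, s0 <= s <= s1 -> t0 <= t <= t1 -> s = s0 \/ s = s1 \/ t = t0 \/ t = t1 ->
    exists s' t', s0 <= s' <= s1 /\ t0 <= t' <= t1 /\
      I p q r a b c (theta s t u) < I p q r a b c (theta s' t' u)) ->
  exists s t, s0 < s < s1 /\ t0 < t < t1 /\ inM p q r a b c (theta s t u).
Proof.
  intros Hu [n1 Hn1] [n2 Hn2] Hs Ht Hbd.
  destruct (rectangle_max s0 s1 t0 t1 u Hu Hs Ht) as [s [t [Bs [Bt Hmax]]]].
  assert (Nb : ~ (s = s0 \/ s = s1 \/ t = t0 \/ t = t1)).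
  { intros X; destruct (Hbd s t Bs Bt X) as [s' [t' [Bs' [Bt' L]]]].
    specialize (Hmax s' t' Bs' Bt'); lra. }
  assert (Is : s0 < s < s1) by lra; assert (It : t0 < t < t1) by lra.
  exists s, t; split; [exact Is|]; split; [exact It|].
  (* A relative radius: (x s, y t) stays in the rectangle when |x - 1| < d and |y - 1| < d. *)
  set (d := Rmin (Rmin (s - s0) (s1 - s) / s) (Rmin (t - t0) (t1 - t) / t)).
  assert (Hd1 : d * s <= Rmin (s - s0) (s1 - s)).
  { replace (Rmin (s - s0) (s1 - s)) with (Rmin (s - s0) (s1 - s) / s * s) by (field; lra).
    apply Rmult_le_compat_r; [lra | apply Rmin_l]. }
  assert (Hd2 : d * t <= Rmin (t - t0) (t1 - t)).
  { replace (Rmin (t - t0) (t1 - t)) with (Rmin (t - t0) (t1 - t) / t * t) by (field; lra).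
    apply Rmult_le_compat_r; [lra | apply Rmin_r]. }
  apply (local_max_inM _ d).
  - apply inE_theta; lra || assumption.
  - exists n1; unfold theta; destruct (parts_cases u n1) as [[? [-> ->]]|]; nra.
  - exists n2; unfold theta; destruct (parts_cases u n2) as [|[? [-> ->]]]; nra.
  - apply Rmin_pos; apply Rdiv_lt_0_compat; try lra; apply Rmin_pos; lra.
  - intros x y Hx Hy Dx%Rabs_def2 Dy%Rabs_def2; rewrite theta_theta by lra.
    generalize (Rmin_l (s - s0) (s1 - s)) (Rmin_r (s - s0) (s1 - s)).
    generalize (Rmin_l (t - t0) (t1 - t)) (Rmin_r (t - t0) (t1 - t)); intros.
    apply Hmax; nra.
Qed.

(** The function is s^q (K - ka ln s): bounded up to s = exp(K/ka), negative beyond. *)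
Lemma fiber_log_le C B : 0 < C -> exists F, 0 <= F /\ forall s, 0 <= s -> fiber_log C B s <= F.
Proof.
  intros HC; set (K := r / q ^ 2 * C - r / q * B); set (ka := r / q * C).
  assert (ka0 : 0 < ka)
    by (apply Rmult_lt_0_compat; [apply Rdiv_lt_0_compat; lra | assumption]).
  assert (Ef : forall s, fiber_log C B s = rpow s q * (K - ka * ln s))
    by (intros; unfold fiber_log, K, ka; ring).
  destruct (rpow_bounded (exp (K / ka))) as [K1 [P1 H1]].
  destruct (rpow_ln_bounded (exp (K / ka))) as [K2 [P2 H2]].
  exists (Rabs K * K1 + ka * K2); split.
  { generalize (Rabs_pos K); nra. }
  intros s Hs; rewrite Ef; destruct (Rle_dec s (exp (K / ka))) as [L|L].
  - assert (As : Rabs s <= exp (K / ka)) by (now rewrite Rabs_pos_eq).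
    specialize (H1 s As); specialize (H2 s As); rewrite (Rabs_pos_eq s Hs) in H1, H2.
    replace (rpow s q * (K - ka * ln s)) with (K * rpow s q + ka * (- (rpow s q * ln s))) by ring.
    apply Rplus_le_compat.
    + eapply Rle_trans; [apply Rle_abs|]; rewrite Rabs_mult.
      apply Rmult_le_compat_l; [apply Rabs_pos | assumption].
    + apply Rmult_le_compat_l; [lra|]; eapply Rle_trans; [apply Rle_abs|].
      now rewrite Rabs_Ropp.
  - assert (K / ka < ln s).
    { rewrite <- (ln_exp (K / ka)); apply ln_increasing; [apply exp_pos | lra]. }
    assert (K < ka * ln s).
    { replace K with (ka * (K / ka)) by (field; lra); now apply Rmult_lt_compat_l. }
    generalize (rpow_ge0 s q) (Rabs_pos K); nra.
Qed.

Lemma fiber_log_neg C B D F : 0 < C -> 0 <= D -> 0 <= F ->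
  exists R0, 1 <= R0 /\ forall s, R0 <= s -> rpow s p * D + F + fiber_log C B s < 0.
Proof.
  intros HC HD HF; set (K := r / q ^ 2 * C - r / q * B); set (ka := r / q * C).
  assert (ka0 : 0 < ka)
    by (apply Rmult_lt_0_compat; [apply Rdiv_lt_0_compat; lra | assumption]).
  assert (Ef : forall s, fiber_log C B s = rpow s q * (K - ka * ln s))
    by (intros; unfold fiber_log, K, ka; ring).
  (* ln s >= z gives K - ka ln s <= - (D + F + 1); then s^q >= s^p >= 1 absorbs both D s^p and F. *)
  set (z := (Rabs K + D + F + 1) / ka).
  assert (z0 : 0 <= z)
    by (apply Rlt_le, Rdiv_lt_0_compat; [generalize (Rabs_pos K); lra | assumption]).
  assert (kz : ka * z = Rabs K + D + F + 1) by (unfold z; field; lra).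
  exists (exp z); split; [generalize (exp_ineq1_le z); lra|].
  intros s Hs; rewrite Ef.
  assert (s1 : 1 <= s) by (generalize (exp_ineq1_le z); lra).
  assert (Lz : z <= ln s) by (rewrite <- (ln_exp z); apply ln_le; [apply exp_pos | lra]).
  assert (X : rpow s p <= rpow s q).
  { rewrite !rpow_Rpower by lra; apply Rle_Rpower; lra. }
  assert (Y : 1 <= rpow s p).
  { rewrite <- (rpow_1 p) at 1; apply rpow_le; lra. }
  assert (ka * z <= ka * ln s) by (apply Rmult_le_compat_l; lra).
  generalize (Rle_abs K); nra.
Qed.

Lemma N_superadd s t u : 0 <= s -> 0 <= t -> E u ->
  N (theta s 0 u) + N (theta 0 t u) <= N (theta s t u).
Proof.
  intros Hs Ht Hu; unfold N, normp.
  assert (X1 := inE_theta s 0 u Hs (Rle_refl 0) Hu).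
  assert (X2 := inE_theta 0 t u (Rle_refl 0) Ht Hu).
  assert (X3 := inE_theta s t u Hs Ht Hu).
  rewrite <- zsum_plus by assumption.
  apply zsum_le; [|now apply zsummable_plus | assumption].
  intros n; unfold normterm.
  assert (F1 : rpow (Rabs (Delta (theta s 0 u) n)) p + rpow (Rabs (Delta (theta 0 t u) n)) p
               <= rpow (Rabs (Delta (theta s t u) n)) p).
  { replace (Delta (theta s t u) n) with (Delta (theta s 0 u) n + Delta (theta 0 t u) n)
      by (rewrite !Delta_theta; ring).
    apply rpow_superadd; [lra|]; rewrite !Delta_theta.
    replace (_ * _) with (s * t * (Delta (posp u) n * Delta (negp u) n)) by ring.
    apply Rmult_le_pos; [now apply Rmult_le_pos | apply Delta_parts_same_sign]. }
  assert (F2 : rpow (Rabs (theta s 0 u n)) p + rpow (Rabs (theta 0 t u n)) p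
               <= rpow (Rabs (theta s t u n)) p).
  { replace (theta s t u n) with (theta s 0 u n + theta 0 t u n) by (unfold theta; ring).
    apply rpow_superadd; [lra|]; unfold theta.
    destruct (parts_cases u n) as [[? [-> ->]]|[? [-> ->]]]; lra. }
  generalize (Ha n) (bpos n); nra.
Qed.

Lemma fiber_log_small C B K : 0 < C -> 0 < K ->
  exists s, 0 < s <= K /\ 0 <= fiber_log C B s.
Proof.
  intros HC HK; set (k0 := r / q ^ 2 * C - r / q * B); set (ka := r / q * C).
  assert (ka0 : 0 < ka)
    by (apply Rmult_lt_0_compat; [apply Rdiv_lt_0_compat; lra | assumption]).
  assert (P := exp_pos (k0 / ka)).
  exists (Rmin K (exp (k0 / ka))); assert (s0 : 0 < Rmin K (exp (k0 / ka))) by now apply Rmin_pos.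
  split; [split; [exact s0 | apply Rmin_l]|].
  set (s := Rmin _ _) in *.
  replace (fiber_log C B s) with (rpow s q * (k0 - ka * ln s))
    by (unfold fiber_log, k0, ka; ring).
  apply Rmult_le_pos; [apply rpow_ge0|].
  assert (L : ln s <= k0 / ka).
  { rewrite <- (ln_exp (k0 / ka)); apply ln_le; [assumption | apply Rmin_r]. }
  assert (ka * ln s <= ka * (k0 / ka)) by (apply Rmult_le_compat_l; lra).
  replace (ka * (k0 / ka)) with k0 in H by (field; lra); lra.
Qed.

(** Maximum over a square [0, K]^2. Off an axis, a small step raises the norm strictly, by
    superadditivity, and does not lower the logarithmic part; on the edges s = K and t = K the
    energy is negative, while it is nonnegative at (0, 0). *)
Lemma projection_inM u : E u -> (exists n, 0 < u n) -> (exists n, u n < 0) ->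
  exists s t, 0 < s /\ 0 < t /\ inM p q r a b c (theta s t u).
Proof.
  intros Hu Hu1 Hu2.
  assert (C1 : 0 < Sc (posp u)).
  { destruct Hu1 as [n Hn]; apply Sc_gt0; [now apply inE_posp|]; exists n.
    destruct (parts_cases u n) as [[_ [-> _]]|]; lra. }
  assert (C2 : 0 < Sc (negp u)).
  { destruct Hu2 as [n Hn]; apply Sc_gt0; [now apply inE_negp|]; exists n.
    destruct (parts_cases u n) as [|[_ [_ ->]]]; lra. }
  destruct (fiber_log_le _ (Sl (posp u)) C1) as [F1 [P1 H1]].
  destruct (fiber_log_le _ (Sl (negp u)) C2) as [F2 [P2 H2]].
  assert (D0 : 0 <= 1 / p * N u).
  { apply Rmult_le_pos; [apply Rlt_le, Rdiv_lt_0_compat; lra | now apply N_ge0]. }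
  (* The additive constant for one part is the global bound for the other, so that the whole far
     edge is negative. *)
  destruct (fiber_log_neg _ (Sl (posp u)) _ _ C1 D0 P2) as [R1 [Q1 G1]].
  destruct (fiber_log_neg _ (Sl (negp u)) _ _ C2 D0 P1) as [R2 [Q2 G2]].
  set (K := Rmax R1 R2).
  assert (K1 : R1 <= K) by apply Rmax_l; assert (K2 : R2 <= K) by apply Rmax_r.
  specialize (G1 K K1); specialize (G2 K K2).
  assert (NK : forall s t, 0 <= s <= K -> 0 <= t <= K ->
            1 / p * N (theta s t u) <= rpow K p * (1 / p * N u)).
  { intros s t Hs Ht; replace (rpow K p * (1 / p * N u)) with (1 / p * (rpow K p * N u)) by ring.
    apply Rmult_le_compat_l; [apply Rlt_le, Rdiv_lt_0_compat; lra|].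
    unfold N, normp; rewrite <- zsum_scal; apply zsum_le.
    - intros n; now apply normterm_theta_le.
    - now apply inE_theta.
    - now apply zsummable_scal. }
  assert (G00 : I p q r a b c (theta 0 0 u) >= 0).
  { rewrite I_theta, !fiber_log_0 by (assumption || lra); rewrite !Rplus_0_r.
    apply Rle_ge, Rmult_le_pos; [apply Rlt_le, Rdiv_lt_0_compat; lra|].
    apply N_ge0, inE_theta; assumption || lra. }
  destruct (interior_max_inM 0 K 0 K u Hu Hu1 Hu2 ltac:(lra) ltac:(lra))
    as [s [t [Hs [Ht HM]]]]; [|now exists s, t; split; [|split]].
  intros s t Hs Ht [-> |[-> |[-> | ->]]].
  - destruct (fiber_log_small _ (Sl (posp u)) K C1 ltac:(lra)) as [x [Hx Fx]].
    exists x, t; split; [lra|]; split; [lra|].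
    rewrite !I_theta, fiber_log_0 by (assumption || lra).
    assert (SA := N_superadd x t u ltac:(lra) ltac:(lra) Hu).
    assert (NP : 0 < N (theta x 0 u)).
    { apply N_gt0; [apply inE_theta; assumption || lra|].
      destruct Hu1 as [n Hn]; exists n; unfold theta.
      destruct (parts_cases u n) as [[_ [-> ->]]|]; nra. }
    assert (1 / p * N (theta 0 t u) < 1 / p * N (theta x t u)); [|lra].
    apply Rmult_lt_compat_l; [apply Rdiv_lt_0_compat; lra | lra].
  - exists 0, 0; split; [lra|]; split; [lra|].
    apply Rlt_le_trans with 0; [|lra]; rewrite I_theta by (assumption || lra).
    specialize (NK K t ltac:(lra) Ht); specialize (H2 t (proj1 Ht)); lra.
  - destruct (fiber_log_small _ (Sl (negp u)) K C2 ltac:(lra)) as [x [Hx Fx]].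
    exists s, x; split; [lra|]; split; [lra|].
    rewrite !I_theta, fiber_log_0 by (assumption || lra).
    assert (SA := N_superadd s x u ltac:(lra) ltac:(lra) Hu).
    assert (NP : 0 < N (theta 0 x u)).
    { apply N_gt0; [apply inE_theta; assumption || lra|].
      destruct Hu2 as [n Hn]; exists n; unfold theta.
      destruct (parts_cases u n) as [|[_ [-> ->]]]; nra. }
    assert (1 / p * N (theta s 0 u) < 1 / p * N (theta s x u)); [|lra].
    apply Rmult_lt_compat_l; [apply Rdiv_lt_0_compat; lra | lra].
  - exists 0, 0; split; [lra|]; split; [lra|].
    apply Rlt_le_trans with 0; [|lra]; rewrite I_theta by (assumption || lra).
    specialize (NK s K Hs ltac:(lra)); specialize (H1 s (proj1 Hs)); lra.
Qed.

(** * Existence of a minimizer *)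

(** [Delta u] and [Delta (posp u)] have the same sign, so the differences contribute nonnegatively;
    the entries contribute exactly b |u^+|^p. *)
Lemma Nd_posp_ge u n : E u -> b n * rpow (Rabs (posp u n)) p <= Nd u (posp u).
Proof.
  intros Hu.
  assert (T : forall m, b m * rpow (Rabs (posp u m)) p <= Nterm u (posp u) m).
  { intros m; unfold Nterm.
    assert (0 <= a m * (phi p (Delta u m) * Delta (posp u) m)).
    { apply Rmult_le_pos; [apply Rlt_le, Ha|]; unfold phi; rewrite Rmult_assoc.
      apply Rmult_le_pos; [apply rpow_ge0|]; rewrite <- (Delta_parts u m).
      generalize (Delta_parts_same_sign u m); nra. }
    assert (phi p (u m) * posp u m = rpow (Rabs (posp u m)) p); [|rewrite H0; lra].
    destruct (parts_cases u m) as [[_ [-> _]]|[_ [-> _]]]; [apply phi_mult_self|].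
    rewrite Rabs_R0, rpow_0; ring. }
  eapply Rle_trans; [apply T|]; apply (zsum_ge_term (Nterm u (posp u))).
  - intros m; eapply Rle_trans; [|apply T].
    apply Rmult_le_pos; [apply Rlt_le, bpos | apply rpow_ge0].
  - apply zsummable_Nterm; [assumption | now apply inE_posp].
Qed.

Lemma Nd_negp_ge u n : E u -> b n * rpow (Rabs (negp u n)) p <= Nd u (negp u).
Proof.
  intros Hu.
  assert (T : forall m, b m * rpow (Rabs (negp u m)) p <= Nterm u (negp u) m).
  { intros m; unfold Nterm.
    assert (0 <= a m * (phi p (Delta u m) * Delta (negp u) m)).
    { apply Rmult_le_pos; [apply Rlt_le, Ha|]; unfold phi; rewrite Rmult_assoc.
      apply Rmult_le_pos; [apply rpow_ge0|]; rewrite <- (Delta_parts u m).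
      generalize (Delta_parts_same_sign u m); nra. }
    assert (phi p (u m) * negp u m = rpow (Rabs (negp u m)) p); [|rewrite H0; lra].
    destruct (parts_cases u m) as [[_ [_ ->]]|[_ [_ ->]]]; [|apply phi_mult_self].
    rewrite Rabs_R0, rpow_0; ring. }
  eapply Rle_trans; [apply T|]; apply (zsum_ge_term (Nterm u (negp u))).
  - intros m; eapply Rle_trans; [|apply T].
    apply Rmult_le_pos; [apply Rlt_le, bpos | apply rpow_ge0].
  - apply zsummable_Nterm; [assumption | now apply inE_negp].
Qed.

Lemma Sl_gt0_large v : E v -> 0 < Sl v -> exists n, 1 < Rabs (v n).
Proof.
  intros Hv H; apply NNPP; intros Hn.
  assert (Sl v <= 0); [|lra].
  destruct (inE_bounded v Hv) as [M HM].
  replace 0 with (zsum (fun n => 0 * (c n * (rpow (Rabs (v n)) q * ln (Rabs (v n))))))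
    by (rewrite zsum_scal; ring).
  apply zsum_le; [|now apply (zsummable_Sl v M) | now apply zsummable_scal, (zsummable_Sl v M)].
  intros n; rewrite Rmult_0_l.
  assert (L : rpow (Rabs (v n)) q * ln (Rabs (v n)) <= 0).
  { destruct (Req_EM_T (v n) 0) as [->|Hv0]; [rewrite Rabs_R0, rpow_0; lra|].
    assert (ln (Rabs (v n)) <= 0).
    { rewrite <- ln_1; apply ln_le; [now apply Rabs_pos_lt|].
      apply Rnot_lt_le; intros L; apply Hn; now exists n. }
    generalize (rpow_ge0 (Rabs (v n)) q); nra. }
  generalize (Hc n); nra.
Qed.

(* [Sl] of a sequence bounded by [1] is nonpositive, so on [M] both parts exceed [1]
   somewhere. *)
Lemma inM_Sl_lower u : inM p q r a b c u -> b0 <= r * Sl (posp u) /\ b0 <= r * Sl (negp u).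
Proof.
  intros [Hu%inD_inE [[n1 H1]%posp_neq0 [[n2 H2]%negp_neq0 [D1 D2]]]].
  rewrite dI_posp in D1; rewrite dI_negp in D2.
  assert (X : forall n, 1 < Rabs (u n) -> b0 <= b n * rpow (Rabs (u n)) p).
  { intros n Hn; assert (1 <= rpow (Rabs (u n)) p)
      by (rewrite <- (rpow_1 p); apply rpow_le; lra).
    generalize (Hb n); nra. }
  split.
  - assert (P : 0 < Nd u (posp u)).
    { eapply Rlt_le_trans; [|apply (Nd_posp_ge u n1 Hu)].
      apply Rmult_lt_0_compat; [apply bpos|]; apply rpow_gt0, Rabs_no_R0.
      destruct (parts_cases u n1) as [[_ [-> _]]|]; lra. }
    destruct (Sl_gt0_large _ (inE_posp u Hu)) as [n Hn]; [nra|].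
    assert (G := Nd_posp_ge u n Hu).
    destruct (parts_cases u n) as [[_ [E1 _]]|[_ [E1 _]]]; rewrite E1 in Hn, G.
    + specialize (X n Hn); lra.
    + rewrite Rabs_R0 in Hn; lra.
  - assert (P : 0 < Nd u (negp u)).
    { eapply Rlt_le_trans; [|apply (Nd_negp_ge u n2 Hu)].
      apply Rmult_lt_0_compat; [apply bpos|]; apply rpow_gt0, Rabs_no_R0.
      destruct (parts_cases u n2) as [|[_ [_ ->]]]; lra. }
    destruct (Sl_gt0_large _ (inE_negp u Hu)) as [n Hn]; [nra|].
    assert (G := Nd_negp_ge u n Hu).
    destruct (parts_cases u n) as [[_ [_ E1]]|[_ [_ E1]]]; rewrite E1 in Hn, G.
    + rewrite Rabs_R0 in Hn; lra.
    + specialize (X n Hn); lra.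
Qed.

Lemma is_lim_Sc (x : nat -> Z -> R) v M : (forall k n, Rabs (x k n) <= M) ->
  (forall n, is_lim_seq (fun k => x k n) (v n)) -> is_lim_seq (fun k => Sc (x k)) (Sc v).
Proof.
  intros HM Hl; destruct (rpow_bounded M) as [K [_ HK]].
  apply (zsum_dominated _ _ (fun n => K * c n)).
  - intros k n; rewrite Rabs_mult, (Rabs_pos_eq (c n)) by apply Rlt_le, Hc.
    specialize (HK (x k n) (HM k n)); generalize (Hc n); nra.
  - now apply zsummable_scal.
  - intros n; apply (is_lim_seq_scal_l _ _ (Finite _)), is_lim_seq_rpow; [lra | apply Hl].
Qed.

Lemma is_lim_Sl (x : nat -> Z -> R) v M : (forall k n, Rabs (x k n) <= M) ->
  (forall n, is_lim_seq (fun k => x k n) (v n)) -> is_lim_seq (fun k => Sl (x k)) (Sl v).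
Proof.
  intros HM Hl; destruct (rpow_ln_bounded M) as [K [_ HK]].
  apply (zsum_dominated _ _ (fun n => K * c n)).
  - intros k n; rewrite Rabs_mult, (Rabs_pos_eq (c n)) by apply Rlt_le, Hc.
    specialize (HK (x k n) (HM k n)); generalize (Hc n); nra.
  - now apply zsummable_scal.
  - intros n; apply (is_lim_seq_scal_l _ _ (Finite _)), is_lim_seq_rpow_ln; [lra | apply Hl].
Qed.

Lemma inM_nonempty : exists u, inM p q r a b c u.
Proof.
  destruct (projection_inM (fun n => zunit 0 n + -1 * zunit 1 n)) as [s [t [_ [_ H]]]].
  - apply (inE_plus (zunit 0) (fun n => -1 * zunit 1 n)); [|apply inE_scal]; apply inE_unit.
  - exists 0%Z; unfold zunit; simpl; lra.
  - exists 1%Z; unfold zunit; simpl; lra.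
  - eexists; exact H.
Qed.

Lemma minimizing_sequence : exists (m : R) (x : nat -> Z -> R),
  (forall u, inM p q r a b c u -> m <= I p q r a b c u) /\
  forall k, inM p q r a b c (x k) /\ I p q r a b c (x k) <= m + / (INR k + 1).
Proof.
  assert (B : bound (fun z => exists u, inM p q r a b c u /\ z = - I p q r a b c u)).
  { exists 0; intros z [u [Hu ->]]; assert (L := I_M_lower u Hu).
    assert (0 <= N u) by apply N_ge0, inD_inE, Hu.
    generalize inv_pq; nra. }
  destruct (completeness _ B) as [m [Hm1 Hm2]].
  { destruct inM_nonempty as [u Hu]; now exists (- I p q r a b c u), u. }
  assert (Hk : forall k, exists u, inM p q r a b c u /\
            I p q r a b c u <= - m + / (INR k + 1)).
  { intros k; apply NNPP; intros Hk.
    assert (e : 0 < / (INR k + 1)) by (apply Rinv_0_lt_compat; generalize (pos_INR k); lra).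
    assert (m <= m - / (INR k + 1)); [|lra].
    apply Hm2; intros z [u [Hu ->]]; apply Rnot_lt_le; intros L; apply Hk; exists u.
    split; [exact Hu | lra]. }
  apply choice in Hk; destruct Hk as [x Hx].
  exists (- m), x; split; [|exact Hx].
  intros u Hu; assert (- I p q r a b c u <= m); [|lra].
  apply Hm1; now exists u.
Qed.

(** The parameters (s, t) that project the limit [v] on M are applied to the sequence itself:
    I(theta s t x_k) <= I(x_k) because x_k tops its fiber, and Fatou's lemma yields I(theta s t v)
    <= m. *)
Lemma minimizer_exists : exists w, inM p q r a b c w /\
  forall u, inM p q r a b c u -> I p q r a b c w <= I p q r a b c u.
Proof.
  destruct minimizing_sequence as [m [x0 [Hm Hx0]]].
  (* Along the sequence (1/p - 1/q) N < I <= m + 1. *)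
  set (K := (m + 1) / (1 / p - 1 / q)).
  assert (Hinv : forall k, / (INR k + 1) <= 1).
  { intros k; rewrite <- Rinv_1; apply Rinv_le_contravar; generalize (pos_INR k); lra. }
  assert (HN0 : forall k, N (x0 k) <= K).
  { intros k; destruct (Hx0 k) as [HM Hk]; assert (L := I_M_lower _ HM).
    apply Rmult_le_reg_l with (1 / p - 1 / q); [apply inv_pq|].
    unfold K; replace (_ * (_ / _)) with (m + 1) by (field; generalize inv_pq; lra).
    specialize (Hinv k); lra. }
  assert (HE0 : forall k, E (x0 k)) by (intros k; apply inD_inE, Hx0).
  set (Mb := rpow (K / b0) (/ p)).
  destruct (diagonal_extraction_Z x0 Mb) as [f [v [Hf Hl]]].
  { intros k n; now apply inE_bound. }
  set (x := fun k => x0 (f k)) in *.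
  assert (HB : forall k n, Rabs (x k n) <= Mb)
    by (intros k n; apply inE_bound; [apply HE0 | apply HN0]).
  assert (Hv : E v).
  { apply (zsum_fatou (fun k => normterm p a b (x k)) _ (fun _ => K) K).
    - intros; apply normterm_ge0.
    - intros k; apply HE0.
    - intros n; now apply is_lim_normterm.
    - intros k; apply HN0.
    - apply is_lim_seq_const. }
  assert (Lth : forall s t n, is_lim_seq (fun k => theta s t (x k) n) (theta s t v n)).
  { intros s t n; apply (is_lim_theta (fun _ => s) (fun _ => t));
      try apply is_lim_seq_const; apply Hl. }
  assert (Bth : forall s t k n, 0 <= s <= 1 -> 0 <= t <= 1 -> Rabs (theta s t (x k) n) <= Mb).
  { intros s t k n Hs Ht; eapply Rle_trans; [apply theta_abs; lra|].
    assert (Rmax s t <= 1) by (apply Rmax_lub; lra).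
    generalize (HB k n) (Rabs_pos (x k n)); nra. }
  assert (LP : forall n, is_lim_seq (fun k => posp (x k) n) (posp v n)).
  { intros n; rewrite <- theta_10; eapply is_lim_seq_ext; [|apply Lth].
    intros k; cbv beta; now rewrite theta_10. }
  assert (LN : forall n, is_lim_seq (fun k => negp (x k) n) (negp v n)).
  { intros n; rewrite <- theta_01; eapply is_lim_seq_ext; [|apply Lth].
    intros k; cbv beta; now rewrite theta_01. }
  assert (BP : forall k n, Rabs (posp (x k) n) <= Mb).
  { intros k n; rewrite <- theta_10; apply Bth; lra. }
  assert (BN : forall k n, Rabs (negp (x k) n) <= Mb).
  { intros k n; rewrite <- theta_01; apply Bth; lra. }
  (* The lower bound b0 of [r * Sl] on M passes to the limit, so neither sign part of [v]
     vanishes. *)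
  assert (HSl : forall (y : nat -> Z -> R) (z : Z -> R),
    (forall k, b0 <= r * Sl (y k)) -> is_lim_seq (fun k => Sl (y k)) (Sl z) ->
    0 < Sl z).
  { intros y z Hy Ly; assert (b0 <= r * Sl z).
    { apply (is_lim_seq_le (fun _ => b0) (fun k => r * Sl (y k)) b0 (r * Sl z));
        [exact Hy | apply is_lim_seq_const | now apply (is_lim_seq_scal_l _ _ (Finite _))]. }
    nra. }
  assert (Hv1 : exists n, 0 < v n).
  { destruct (Sl_gt0_large (posp v)) as [n Hn]; [now apply inE_posp | |].
    - apply (HSl (fun k => posp (x k))); [intros k; apply inM_Sl_lower, Hx0|].
      now apply (is_lim_Sl _ _ Mb).
    - exists n; destruct (parts_cases v n) as [|[_ [E1 _]]]; [lra|].
      rewrite E1, Rabs_R0 in Hn; lra. }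
  assert (Hv2 : exists n, v n < 0).
  { destruct (Sl_gt0_large (negp v)) as [n Hn]; [now apply inE_negp | |].
    - apply (HSl (fun k => negp (x k))); [intros k; apply inM_Sl_lower, Hx0|].
      now apply (is_lim_Sl _ _ Mb).
    - exists n; destruct (parts_cases v n) as [[_ [_ E1]]|[[H|H] _]]; [|exact H|];
        [rewrite E1, Rabs_R0 in Hn; lra|].
      exfalso; destruct (parts_cases v n) as [[? _]|[_ [_ E1]]]; [lra|].
      rewrite E1, H, Rabs_R0 in Hn; lra. }
  destruct (projection_inM v Hv Hv1 Hv2) as [s [t [Hs [Ht HM]]]].
  exists (theta s t v); split; [exact HM|].
  assert (I p q r a b c (theta s t v) <= m); [|intros u Hu; specialize (Hm u Hu); lra].
  rewrite I_theta by (assumption || lra).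
  set (fib := fun u => fiber_log (Sc (posp u)) (Sl (posp u)) s
                     + fiber_log (Sc (negp u)) (Sl (negp u)) t).
  assert (Lf : is_lim_seq (fun k => fib (x k)) (fib v)).
  { assert (FL : forall (y : nat -> Z -> R) (z : Z -> R) s', (forall k n, Rabs (y k n) <= Mb) ->
      (forall n, is_lim_seq (fun k => y k n) (z n)) ->
      is_lim_seq (fun k => fiber_log (Sc (y k)) (Sl (y k)) s') (fiber_log (Sc z) (Sl z) s')).
    { intros y z s' H1 H2; unfold fiber_log; apply (is_lim_seq_scal_l _ _ (Finite _)).
      assert (L1 := is_lim_Sc y z Mb H1 H2); assert (L2 := is_lim_Sl y z Mb H1 H2).
      apply is_lim_seq_minus'; apply (is_lim_seq_scal_l _ _ (Finite _)); [assumption|].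
      apply is_lim_seq_plus'; [assumption|]; now apply (is_lim_seq_scal_l _ _ (Finite _)). }
    apply is_lim_seq_plus'; [apply (FL (fun k => posp (x k))) | apply (FL (fun k => negp (x k)))];
      assumption. }
  assert (F : zsum (normterm p a b (theta s t v)) <= p * (m - fib v)).
  { apply (zsum_fatou (fun k => normterm p a b (theta s t (x k))) _
      (fun k => p * (m + / (INR (f k) + 1) - fib (x k)))).
    - intros; apply normterm_ge0.
    - intros k; apply inE_theta; try lra; apply HE0.
    - intros n; apply is_lim_normterm; intros; apply Lth.
    - intros k; destruct (Hx0 (f k)) as [HMk Hk].
      assert (L := I_M_max s t (x k) ltac:(lra) ltac:(lra) HMk).
      rewrite I_theta in L by (lra || apply HE0).
      change (zsum _) with (N (theta s t (x k))).
      replace (N (theta s t (x k))) with (p * (1 / p * N (theta s t (x k)))) by (field; lra).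
      apply Rmult_le_compat_l; [lra|]; unfold fib, x in *; lra.
    - apply (is_lim_seq_scal_l _ _ (Finite _)), is_lim_seq_minus'; [|exact Lf].
      apply (is_lim_seq_ext (fun k => m + (0 - - / (INR (f k) + 1)))); [intros; ring|].
      replace (Finite m) with (Finite (m + (0 - 0))) by (f_equal; ring).
      apply is_lim_seq_plus'; [apply is_lim_seq_const|].
      apply is_lim_seq_minus'; [apply is_lim_seq_const|].
      eapply is_lim_seq_ext; [|apply (is_lim_seq_extract _ _ f Hf (is_lim_seq_inv_INR 0))].
      intros k; simpl; ring. }
  change (zsum _) with (N (theta s t v)) in F.
  assert (1 / p * N (theta s t v) <= m - fib v); [|unfold fib in *; lra].
  replace (m - fib v) with (1 / p * (p * (m - fib v))) by (field; lra).
  apply Rmult_le_compat_l; [apply Rlt_le, Rdiv_lt_0_compat; lra | exact F].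
Qed.

(** * The minimizer is critical *)

(** The part of [I] that depends on the entry y at [n], with the entries l at [n - 1] and m at
    [n + 1] held fixed. *)
Definition site_energy (n : Z) (l m y : R) : R :=
  1 / p * (a (n - 1)%Z * rpow (Rabs (y - l)) p + a n * rpow (Rabs (m - y)) p
           + b n * rpow (Rabs y) p)
  + r / q ^ 2 * (c n * rpow (Rabs y) q)
  - r / q * (c n * (rpow (Rabs y) q * ln (Rabs y))).

(** The left side minus the right side of the difference equation in (P) at the site [n]. *)
Definition site_force (n : Z) (l m y : R) : R :=
  a (n - 1)%Z * phi p (y - l) - a n * phi p (m - y) + b n * phi p y
  - r * (c n * (phi q y * ln (Rabs y))).

Lemma is_derive_site_energy n (l m y : R) :
  is_derive (site_energy n l m) y (site_force n l m y).
Proof.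
  assert (D1 : is_derive (fun y => rpow (Rabs (y - l)) p) y (p * phi p (y - l))).
  { replace (p * phi p (y - l)) with (1 * (p * phi p (y - l))) by ring.
    apply (is_derive_comp (fun y => rpow (Rabs y) p) (fun y => y - l));
      [now apply is_derive_rpow | auto_derive; [exact Logic.I | ring]]. }
  assert (D2 : is_derive (fun y => rpow (Rabs (m - y)) p) y (-1 * (p * phi p (m - y)))).
  { apply (is_derive_comp (fun y => rpow (Rabs y) p) (fun y => m - y));
      [now apply is_derive_rpow | auto_derive; [exact Logic.I | ring]]. }
  assert (D3 := is_derive_rpow p y Hp).
  assert (D4 := is_derive_rpow q y ltac:(lra)).
  assert (D5 := is_derive_rpow_ln q y ltac:(lra)).
  replace (site_force n l m y) with
    (1 / p * (a (n - 1)%Z * (p * phi p (y - l)) + a n * (-1 * (p * phi p (m - y)))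
              + b n * (p * phi p y))
     + r / q ^ 2 * (c n * (q * phi q y))
     - r / q * (c n * (phi q y * (q * ln (Rabs y) + 1))))
    by (unfold site_force; field; lra).
  unfold site_energy.
  apply (@is_derive_minus R_AbsRing R_NormedModule (fun y => _ + _) (fun y => _ * _)).
  - apply (@is_derive_plus R_AbsRing R_NormedModule (fun y => _ * _) (fun y => _ * _)).
    + apply is_derive_scal.
      apply (@is_derive_plus R_AbsRing R_NormedModule (fun y => _ + _) (fun y => _ * _)).
      * apply (@is_derive_plus R_AbsRing R_NormedModule (fun y => _ * _) (fun y => _ * _));
          now apply is_derive_scal.
      * now apply is_derive_scal.
    + now apply is_derive_scal, is_derive_scal.
  - now apply is_derive_scal, is_derive_scal.
Qed.

Lemma zunit_refl n : zunit n n = 1.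
Proof. unfold zunit; destruct (Z.eq_dec n n); [reflexivity | contradiction]. Qed.

Lemma dI_unit u n : dI p q r a b c u (zunit n) = site_force n (u (n - 1)%Z) (u (n + 1)%Z) (u n).
Proof.
  rewrite dI_eq; unfold Nd, Ld, site_force.
  rewrite (zsum_two (Nterm u (zunit n)) n), (zsum_two (fun m => c m * _) n).
  - unfold Nterm, Delta; replace (n - 1 + 1)%Z with n by lia.
    rewrite zunit_refl, (zunit_0 n (n - 1)), (zunit_0 n (n + 1)) by lia; ring.
  - intros m _ H; rewrite zunit_0 by assumption; ring.
  - intros m H1 H2; unfold Nterm; rewrite Delta_unit_0, zunit_0 by assumption; ring.
Qed.

Lemma I_site u v n : E u -> E v -> (forall m, m <> n -> v m = u m) ->
  I p q r a b c v - I p q r a b c u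
  = site_energy n (u (n - 1)%Z) (u (n + 1)%Z) (v n)
    - site_energy n (u (n - 1)%Z) (u (n + 1)%Z) (u n).
Proof.
  intros Hu Hv H; rewrite !I_eq.
  destruct (inE_bounded u Hu) as [M1 B1]; destruct (inE_bounded v Hv) as [M2 B2].
  assert (X1 : N v - N u = normterm p a b v (n - 1) + normterm p a b v n
     - (normterm p a b u (n - 1) + normterm p a b u n)).
  { unfold N, normp; rewrite <- zsum_minus by assumption; rewrite (zsum_two _ n); [ring|].
    intros m H1 H2; unfold normterm, Delta; rewrite !H by lia; ring. }
  assert (X2 : Sc v - Sc u = c n * rpow (Rabs (v n)) q - c n * rpow (Rabs (u n)) q).
  { unfold Sc; rewrite <- zsum_minus
      by ((now apply (zsummable_Sc v M2)) || now apply (zsummable_Sc u M1)).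
    rewrite (zsum_two _ n); [rewrite (H (n - 1)%Z) by lia; ring|].
    intros m H1 H2; rewrite !H by lia; ring. }
  assert (X3 : Sl v - Sl u = c n * (rpow (Rabs (v n)) q * ln (Rabs (v n)))
                           - c n * (rpow (Rabs (u n)) q * ln (Rabs (u n)))).
  { unfold Sl; rewrite <- zsum_minus
      by ((now apply (zsummable_Sl v M2)) || now apply (zsummable_Sl u M1)).
    rewrite (zsum_two _ n); [rewrite (H (n - 1)%Z) by lia; ring|].
    intros m H1 H2; rewrite !H by lia; ring. }
  unfold normterm, Delta in X1; replace (n - 1 + 1)%Z with n in X1 by lia.
  rewrite (H (n - 1)%Z), (H (n + 1)%Z) in X1 by lia.
  replace (_ - _) with (1 / p * (N v - N u) + r / q ^ 2 * (Sc v - Sc u) - r / q * (Sl v - Sl u))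
    by ring.
  rewrite X1, X2, X3; unfold site_energy; ring.
Qed.

Lemma continuous_eps (f : R -> R) x k eta : continuous f x -> 0 < k -> 0 < eta ->
  exists d, 0 < d /\ forall y, Rabs (y - x) < d -> k * Rabs (f y - f x) < eta.
Proof.
  intros Hf Hk Heta.
  assert (e : 0 < eta / k) by now apply Rdiv_lt_0_compat.
  destruct (Hf (ball (f x) (mkposreal _ e)) (locally_ball _ _)) as [d Hd].
  exists d; split; [apply cond_pos|]; intros y Hy; specialize (Hd y Hy).
  change (Rabs (f y - f x) < eta / k) in Hd.
  replace eta with (k * (eta / k)) by (field; lra); now apply Rmult_lt_compat_l.
Qed.

Lemma site_force_sign n (l0 m0 y0 : R) : site_force n l0 m0 y0 <> 0 ->
  exists d, 0 < d /\ forall l m y : R,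
    Rabs (l - l0) < d -> Rabs (m - m0) < d -> Rabs (y - y0) < d ->
    0 < site_force n l0 m0 y0 * site_force n l m y.
Proof.
  set (D := site_force n l0 m0 y0); intros HD.
  (* The force has four terms; if each moves by less than |D|/4, its sign is kept. *)
  assert (T : 0 < Rabs D / 4) by (generalize (Rabs_pos_lt _ HD); lra).
  destruct (continuous_eps _ _ _ _ (continuous_phi p (y0 - l0) Hp) (Ha (n - 1)%Z) T)
    as [d1 [P1 H1]].
  destruct (continuous_eps _ _ _ _ (continuous_phi p (m0 - y0) Hp) (Ha n) T)
    as [d2 [P2 H2]].
  destruct (continuous_eps _ _ _ _ (continuous_phi p y0 Hp) (bpos n) T) as [d3 [P3 H3]].
  destruct (continuous_eps _ _ _ _ (continuous_phi_ln q y0 ltac:(lra))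
    (Rmult_lt_0_compat _ _ Hr (Hc n)) T) as [d4 [P4 H4]].
  (* The halves are due to y - l and m - y, in which two values move. *)
  set (d := Rmin (Rmin (d1 / 2) (d2 / 2)) (Rmin d3 d4)).
  assert (d <= d1 / 2 /\ d <= d2 / 2 /\ d <= d3 /\ d <= d4) as [B1 [B2 [B3 B4]]].
  { unfold d; generalize (Rmin_l (Rmin (d1 / 2) (d2 / 2)) (Rmin d3 d4))
      (Rmin_r (Rmin (d1 / 2) (d2 / 2)) (Rmin d3 d4)) (Rmin_l (d1 / 2) (d2 / 2))
      (Rmin_r (d1 / 2) (d2 / 2)) (Rmin_l d3 d4) (Rmin_r d3 d4); lra. }
  exists d; split; [repeat apply Rmin_pos; lra|].
  intros l m y Hl%Rabs_def2 Hm%Rabs_def2 Hy; assert (Hy' := Hy); apply Rabs_def2 in Hy'.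
  specialize (H1 (y - l) ltac:(apply Rabs_def1; lra)).
  specialize (H2 (m - y) ltac:(apply Rabs_def1; lra)).
  specialize (H3 y ltac:(lra)); specialize (H4 y ltac:(lra)).
  rewrite <- (Rabs_pos_eq (a (n - 1)%Z)), <- Rabs_mult in H1 by apply Rlt_le, Ha.
  rewrite <- (Rabs_pos_eq (a n)), <- Rabs_mult in H2 by apply Rlt_le, Ha.
  rewrite <- (Rabs_pos_eq (b n)), <- Rabs_mult in H3 by apply Rlt_le, bpos.
  rewrite <- (Rabs_pos_eq (r * c n)), <- Rabs_mult in H4
    by (apply Rlt_le, Rmult_lt_0_compat; [exact Hr | apply Hc]).
  assert (X : Rabs (site_force n l m y - D) < Rabs D).
  { replace (site_force n l m y - D) with
      (a (n - 1)%Z * (phi p (y - l) - phi p (y0 - l0)) - a n * (phi p (m - y) - phi p (m0 - y0))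
       + b n * (phi p y - phi p y0)
       - r * c n * (phi q y * ln (Rabs y) - phi q y0 * ln (Rabs y0)))
      by (unfold D, site_force; ring).
    apply Rabs_def2 in H1; apply Rabs_def2 in H2.
    apply Rabs_def2 in H3; apply Rabs_def2 in H4.
    apply Rabs_def1; lra. }
  unfold Rabs in X; destruct (Rcase_abs D), (Rcase_abs (site_force n l m y - D)); nra.
Qed.

Lemma theta_at s t u v n m : u n = v m -> theta s t u n = theta s t v m.
Proof. intros H; unfold theta, posp, negp; now rewrite H. Qed.

Lemma theta_close s t d u n : 0 <= d -> Rabs (s - 1) <= d -> Rabs (t - 1) <= d ->
  Rabs (theta s t u n - u n) <= d * Rabs (u n).
Proof.
  intros Hd Hs Ht; unfold theta; destruct (parts_cases u n) as [[? [-> ->]]|[? [-> ->]]].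
  - replace (s * u n + t * 0 - u n) with ((s - 1) * u n) by ring.
    rewrite Rabs_mult; apply Rmult_le_compat_r; [apply Rabs_pos | assumption].
  - replace (s * 0 + t * u n - u n) with ((t - 1) * u n) by ring.
    rewrite Rabs_mult; apply Rmult_le_compat_r; [apply Rabs_pos | assumption].
Qed.

(** At each site [theta s t] acts by the increasing map x -> s x^+ + t x^-, so a shift of one entry
    moves that entry in the same direction at all points of the fiber. *)
Lemma theta_increasing s t u v n : 0 < s -> 0 < t -> u n < v n ->
  theta s t u n < theta s t v n.
Proof.
  intros Hs Ht H; unfold theta; destruct (parts_cases u n) as [[? [-> ->]]|[? [-> ->]]],
    (parts_cases v n) as [[? [-> ->]]|[? [-> ->]]]; nra.
Qed.

(** Mean value theorem; [D] only carries the sign of the force. *)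
Lemma site_descent n (l m y y' D : R) :
  (forall x, Rmin y y' <= x <= Rmax y y' -> 0 < D * site_force n l m x) ->
  D * (y' - y) < 0 -> site_energy n l m y' < site_energy n l m y.
Proof.
  intros H Hy.
  destruct (MVT_gen (site_energy n l m) y y' (site_force n l m)) as [x [Hx Ex]].
  - intros; apply is_derive_site_energy.
  - intros x _; apply continuity_pt_filterlim.
    eapply is_derive_continuous, is_derive_site_energy.
  - specialize (H x Hx); nra.
Qed.

Section Minimizer.
Context (w : Z -> R).
Context (HwM : inM p q r a b c w).
Context (Hmin : forall u, inM p q r a b c u -> I p q r a b c w <= I p q r a b c u).

Let Hw : E w.
Proof. apply inD_inE, HwM. Qed.

(** On each edge one of s, t equals 1 - d or 1 + d, where h is positive. The defect in [I_fibering]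
    then gives an explicit [eta], uniform along the edges. *)
Lemma minimizer_boundary_gap d : 0 < d < 1 -> exists eta, 0 < eta /\
  forall s t, 0 <= s -> 0 <= t -> s = 1 - d \/ s = 1 + d \/ t = 1 - d \/ t = 1 + d ->
  I p q r a b c (theta s t w) <= I p q r a b c w - eta.
Proof.
  intros Hd; destruct HwM as [_ [[n1 H1]%posp_neq0 [[n2 H2]%negp_neq0 [D1 D2]]]].
  set (h := fun s => 1 - rpow s q + rpow s q * ln (rpow s q)).
  assert (h0' : forall s, 0 <= h s) by (intros s; apply h0, rpow_ge0).
  assert (h1 : forall s, 0 <= s -> s <> 1 -> 0 < h s).
  { intros s Hs Hs1; assert (X := xlnx_gt (rpow s q) (rpow_ge0 _ _)).
    assert (rpow s q <> 1); [|unfold h; specialize (X H); lra].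
    destruct (Rdichotomy _ _ Hs1) as [L|L].
    - assert (Y := rpow_lt s 1 q ltac:(lra) ltac:(lra)); rewrite rpow_1 in Y; lra.
    - assert (Y := rpow_lt 1 s q ltac:(lra) ltac:(lra)); rewrite rpow_1 in Y; lra. }
  set (C1 := Sc (posp w)); set (C2 := Sc (negp w)).
  assert (P1 : 0 < C1).
  { apply Sc_gt0; [now apply inE_posp|]; exists n1.
    destruct (parts_cases w n1) as [[_ [-> _]]|]; lra. }
  assert (P2 : 0 < C2).
  { apply Sc_gt0; [now apply inE_negp|]; exists n2.
    destruct (parts_cases w n2) as [|[_ [_ ->]]]; lra. }
  set (hm := Rmin (h (1 - d)) (h (1 + d))); set (Cm := Rmin C1 C2).
  assert (hm0 : 0 < hm) by (apply Rmin_pos; apply h1; lra).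
  assert (Cm0 : 0 < Cm) by now apply Rmin_pos.
  assert (hm1 : forall s, s = 1 - d \/ s = 1 + d -> hm <= h s)
    by (intros s [-> | ->]; [apply Rmin_l | apply Rmin_r]).
  assert (Cm1 : Cm <= C1) by apply Rmin_l; assert (Cm2 : Cm <= C2) by apply Rmin_r.
  exists (r / q ^ 2 * (Cm * hm)); split.
  { apply Rmult_lt_0_compat; [apply rq | now apply Rmult_lt_0_compat]. }
  intros s t Hs Ht Hb'; assert (F := I_fibering s t w Hs Ht Hw).
  rewrite D1, D2 in F; fold (h s) (h t) C1 C2 in F.
  assert (r / q ^ 2 * (Cm * hm) <= r / q ^ 2 * (C1 * h s + C2 * h t)); [|lra].
  apply Rmult_le_compat_l; [apply Rlt_le, rq|].
  generalize (h0' s) (h0' t); intros.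
  assert (hm <= h s \/ hm <= h t) as [X|X]
    by (destruct Hb' as [X|[X|[X|X]]]; [left|left|right|right]; apply hm1; auto).
  - assert (Cm * hm <= C1 * h s) by (apply Rmult_le_compat; lra); nra.
  - assert (Cm * hm <= C2 * h t) by (apply Rmult_le_compat; lra); nra.
Qed.

(* If the force at the site [n] does not vanish, moving [w n] slightly against it lowers
   [I] along all of [theta s t], [(s, t)] near [(1, 1)]; the perturbed fiber still has an
   interior local maximum, which is a point of the Nehari set below the minimum. *)
Lemma minimizer_site n : dI p q r a b c w (zunit n) = 0.
Proof.
  rewrite dI_unit; apply NNPP; intros HD.
  set (D := site_force n (w (n - 1)%Z) (w (n + 1)%Z) (w n)) in *.
  destruct (site_force_sign _ _ _ _ HD) as [rho [Hrho Hsign]]; fold D in Hsign.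
  destruct HwM as [_ [[n1 H1]%posp_neq0 [[n2 H2]%negp_neq0 _]]].
  set (W := Rabs (w (n - 1)%Z) + Rabs (w n) + Rabs (w (n + 1)%Z) + 1).
  assert (W0 : 1 <= W).
  { unfold W; generalize (Rabs_pos (w (n - 1)%Z)) (Rabs_pos (w n)) (Rabs_pos (w (n + 1)%Z)).
    lra. }
  (* [d * W <= rho / 2] keeps the entries of [theta s t w] around [n] within the radius where the
     force keeps its sign; [d <= 1 / 2] keeps s and t positive. *)
  set (d := Rmin (1 / 2) (rho / 2 / W)).
  assert (d0 : 0 < d) by (apply Rmin_pos; [lra | apply Rdiv_lt_0_compat; lra]).
  assert (d1 : d <= 1 / 2) by apply Rmin_l.
  assert (dW : d * W <= rho / 2).
  { replace (rho / 2) with (rho / 2 / W * W) by (field; lra).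
    apply Rmult_le_compat_r; [lra | apply Rmin_r]. }
  destruct (minimizer_boundary_gap d ltac:(lra)) as [eta [Heta Hgap]].
  destruct (continuous_eps (site_energy n (w (n - 1)%Z) (w (n + 1)%Z)) (w n) 1 eta
    (is_derive_continuous _ _ _ (is_derive_site_energy n _ _ _)) Rlt_0_1 Heta) as [k [Hk Hcont]].
  (* Bound on the shift: rho/2 is what remains of the radius, k keeps the change of I(w) below
     [eta], and w n1 and - w n2 preserve both signs. *)
  set (z := Rmin (Rmin (1 / 2) (rho / 2)) (Rmin k (Rmin (w n1) (- w n2)))).
  assert (z0 : 0 < z) by (repeat apply Rmin_pos; lra).
  assert (z <= 1 / 2 /\ z <= rho / 2 /\ z <= k /\ z <= w n1 /\ z <= - w n2)
    as [z1 [z2 [z3 [z4 z5]]]].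
  { unfold z; generalize (Rmin_l (Rmin (1 / 2) (rho / 2)) (Rmin k (Rmin (w n1) (- w n2))))
      (Rmin_r (Rmin (1 / 2) (rho / 2)) (Rmin k (Rmin (w n1) (- w n2))))
      (Rmin_l (1 / 2) (rho / 2)) (Rmin_r (1 / 2) (rho / 2))
      (Rmin_l k (Rmin (w n1) (- w n2))) (Rmin_r k (Rmin (w n1) (- w n2)))
      (Rmin_l (w n1) (- w n2)) (Rmin_r (w n1) (- w n2)); lra. }
  assert (exists e, D * e < 0 /\ Rabs e < z) as [e [HDe He]].
  { destruct (Rdichotomy _ _ HD) as [L|L].
    - exists (z / 2); split; [nra | rewrite Rabs_pos_eq; lra].
    - exists (- (z / 2)); split; [nra | rewrite Rabs_Ropp, Rabs_pos_eq; lra]. }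
  set (we := fun m => w m + e * zunit n m).
  assert (Ewe : E we) by (apply inE_plus; [exact Hw | apply inE_scal, inE_unit]).
  assert (we_n : we n = w n + e) by (unfold we; rewrite zunit_refl; ring).
  assert (we_m : forall m, m <> n -> we m = w m)
    by (intros m Hm; unfold we; rewrite zunit_0 by assumption; ring).
  assert (we_close : forall m, Rabs (we m - w m) < z).
  { intros m; destruct (Z.eq_dec m n) as [->|Hm].
    - rewrite we_n; now replace (w n + e - w n) with e by ring.
    - rewrite we_m, Rminus_diag, Rabs_R0; assumption. }
  assert (Hwe1 : I p q r a b c w - eta < I p q r a b c we).
  { assert (X := I_site w we n Hw Ewe we_m).
    specialize (Hcont (we n) ltac:(generalize (we_close n); lra)).
    rewrite Rmult_1_l in Hcont; apply Rabs_def2 in Hcont; lra. }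
  assert (Hlow : forall s t, 1 - d <= s <= 1 + d -> 1 - d <= t <= 1 + d ->
            I p q r a b c (theta s t we) < I p q r a b c (theta s t w)).
  { intros s t Hs Ht.
    assert (Ds : Rabs (s - 1) <= d) by (apply Rabs_le; lra).
    assert (Dt : Rabs (t - 1) <= d) by (apply Rabs_le; lra).
    assert (X := I_site (theta s t w) (theta s t we) n
      (inE_theta s t w ltac:(lra) ltac:(lra) Hw) (inE_theta s t we ltac:(lra) ltac:(lra) Ewe)
      (fun m Hm => theta_at s t _ _ _ _ (we_m m Hm))).
    assert (site_energy n (theta s t w (n - 1)%Z) (theta s t w (n + 1)%Z) (theta s t we n)
       < site_energy n (theta s t w (n - 1)%Z) (theta s t w (n + 1)%Z) (theta s t w n)); [|lra].
    assert (near : forall m, Rabs (w m) + 1 <= W -> Rabs (theta s t w m - w m) < rho).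
    { intros m Hm; eapply Rle_lt_trans; [now apply (theta_close s t d); lra|].
      generalize (Rabs_pos (w m)); nra. }
    assert (near1 := near (n - 1)%Z).
    assert (near2 := near (n + 1)%Z). assert (near3 := near n).
    assert (near4 : Rabs (theta s t we n - w n) < rho).
    { replace (theta s t we n - w n) with ((theta s t we n - we n) + (we n - w n)) by ring.
      eapply Rle_lt_trans; [apply Rabs_triang|].
      assert (T := theta_close s t d we n ltac:(lra) Ds Dt).
      assert (T2 : Rabs (we n) <= W).
      { rewrite we_n; eapply Rle_trans; [apply Rabs_triang|]; unfold W.
        generalize (Rabs_pos (w (n - 1)%Z)) (Rabs_pos (w (n + 1)%Z)); lra. }
      assert (d * Rabs (we n) <= d * W) by (apply Rmult_le_compat_l; lra).
      generalize (we_close n); lra. }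
    unfold W in near1, near2, near3.
    generalize (Rabs_pos (w (n - 1)%Z)) (Rabs_pos (w n)) (Rabs_pos (w (n + 1)%Z)); intros.
    apply (site_descent _ _ _ _ _ D).
    - intros x Hx; apply Hsign; [apply near1; lra | apply near2; lra|].
      specialize (near3 ltac:(lra)); apply Rabs_def2 in near3; apply Rabs_def2 in near4.
      unfold Rmin, Rmax in Hx; destruct (Rle_dec (theta s t w n) (theta s t we n));
        apply Rabs_def1; lra.
    - destruct (Rdichotomy _ _ HD) as [L|L].
      + assert (theta s t w n < theta s t we n) by (apply theta_increasing; nra); nra.
      + assert (theta s t we n < theta s t w n) by (apply theta_increasing; nra); nra. }
  destruct (interior_max_inM (1 - d) (1 + d) (1 - d) (1 + d) we Ewe) as [s [t [Hs [Ht HM]]]].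
  - exists n1; generalize (we_close n1); intros X%Rabs_def2; lra.
  - exists n2; generalize (we_close n2); intros X%Rabs_def2; lra.
  - lra.
  - lra.
  (* On the edges, I(theta s t we) < I(theta s t w) <= I(w) - eta < I(we). *)
  - intros s t Hs Ht Hbd; exists 1, 1; split; [lra|]; split; [lra|]; rewrite theta_1.
    specialize (Hlow s t Hs Ht); specialize (Hgap s t ltac:(lra) ltac:(lra) Hbd); lra.
  (* The contradiction is I(w) <= I(theta s t we) < I(theta s t w) <= I(w). *)
  - assert (L1 := Hmin _ HM); specialize (Hlow s t ltac:(lra) ltac:(lra)).
    assert (L2 := I_M_max s t w ltac:(lra) ltac:(lra) HwM); lra.
Qed.

(** * From single sites to all test sequences *)

Lemma Nterm_plus u v v' n : Nterm u (fun m => v m + v' m) n = Nterm u v n + Nterm u v' n.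
Proof. unfold Nterm; rewrite Delta_plus; ring. Qed.

Lemma dI_plus u v v' : E u -> E v -> E v' ->
  dI p q r a b c u (fun n => v n + v' n) = dI p q r a b c u v + dI p q r a b c u v'.
Proof.
  intros Hu Hv Hv'; rewrite !dI_eq; unfold Nd, Ld.
  destruct (inE_bounded u Hu) as [M B]; destruct (inE_bounded v Hv) as [M1 B1].
  destruct (inE_bounded v' Hv') as [M2 B2].
  rewrite (zsum_ext _ _ (Nterm_plus u v v')), zsum_plus by now apply zsummable_Nterm.
  rewrite (zsum_ext (fun n => c n * (_ * (_ + _)))
    (fun n => c n * (phi q (u n) * ln (Rabs (u n)) * v n)
            + c n * (phi q (u n) * ln (Rabs (u n)) * v' n))) by (intros; ring).
  rewrite zsum_plus; [ring | now apply (zsummable_Ld u M B v M1)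
                           | now apply (zsummable_Ld u M B v' M2)].
Qed.

Lemma dI_scal u v x : dI p q r a b c u (fun n => x * v n) = x * dI p q r a b c u v.
Proof.
  rewrite !dI_eq; unfold Nd, Ld.
  assert (X1 : zsum (Nterm u (fun n => x * v n)) = x * zsum (Nterm u v)).
  { rewrite <- zsum_scal; apply zsum_ext; intros n; unfold Nterm, Delta; ring. }
  assert (X2 : zsum (fun n => c n * (phi q (u n) * ln (Rabs (u n)) * (x * v n)))
             = x * zsum (fun n => c n * (phi q (u n) * ln (Rabs (u n)) * v n))).
  { rewrite <- zsum_scal; apply zsum_ext; intros n; ring. }
  rewrite X1, X2; ring.
Qed.

Lemma minimizer_finite_support (k : nat) : forall v, E v ->
  (forall n, (Z.of_nat k <= Z.abs n)%Z -> v n = 0) -> dI p q r a b c w v = 0.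
Proof.
  induction k as [|k IH]; intros v Hv H0.
  - replace v with (fun n => 0 * v n)
      by (apply functional_extensionality; intros n; rewrite H0 by lia; ring).
    rewrite dI_scal; ring.
  - set (kz := Z.of_nat k).
    assert (Hdel : forall v' n, E v' -> dI p q r a b c w (fun m => v' m + - v' n * zunit n m)
              = dI p q r a b c w v').
    { intros v' n Hv'; rewrite dI_plus; [| exact Hw | exact Hv' | apply inE_scal, inE_unit].
      rewrite dI_scal, minimizer_site; ring. }
    assert (Edel : forall v' n, E v' -> E (fun m => v' m + - v' n * zunit n m)).
    { intros v' n Hv'; apply inE_plus; [exact Hv' | apply inE_scal, inE_unit]. }
    rewrite <- (Hdel v kz Hv).
    assert (Hv1 := Edel v kz Hv); set (v1 := fun m => v m + _) in *.
    (* The two outermost entries are removed in turn. For k = 0 the sites coincide and the second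
       removal subtracts 0. *)
    rewrite <- (Hdel v1 (- kz)%Z Hv1).
    apply IH; [now apply Edel|].
    assert (Z0 : forall m, (kz <= Z.abs m)%Z -> m <> kz -> m <> (- kz)%Z -> v1 m = 0).
    { intros m Hm Hm1 Hm2; unfold v1; rewrite zunit_0, H0 by lia; ring. }
    assert (Z1 : v1 kz = 0) by (unfold v1; rewrite zunit_refl; ring).
    intros m Hm; destruct (Z.eq_dec m (- kz)) as [->|Hm2]; [rewrite zunit_refl; ring|].
    rewrite (zunit_0 (- kz) m) by assumption.
    destruct (Z.eq_dec m kz) as [->|Hm1]; [rewrite Z1; ring|].
    rewrite Z0 by assumption; ring.
Qed.

(** Soft thresholding: x minus its projection onto [-d, d]. *)
Definition soft (d x : R) : R := x - Rmax (- d) (Rmin d x).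

Lemma soft_spec d x y : 0 < d ->
  Rabs (soft d x - soft d y) <= Rabs (x - y) /\ Rabs (soft d x) <= Rabs x
  /\ Rabs (soft d x - x) <= d /\ (Rabs x <= d -> soft d x = 0).
Proof.
  intros Hd.
  assert (S : forall z, (d < z /\ soft d z = z - d) \/ (z < - d /\ soft d z = z + d)
                       \/ (- d <= z <= d /\ soft d z = 0)).
  { intros z; unfold soft, Rmax, Rmin; destruct (Rle_dec d z);
      match goal with |- context [Rle_dec ?a ?b] => destruct (Rle_dec a b) end; lra. }
  destruct (S x) as [[Hx ->]|[[Hx ->]|[Hx ->]]], (S y) as [[Hy ->]|[[Hy ->]|[Hy ->]]];
    repeat split; unfold Rabs;
    repeat (match goal with |- context [Rcase_abs ?a] => destruct (Rcase_abs a) end);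
    lra.
Qed.

(** The terms b |u|^p of a convergent series tend to 0 and b is at least b0. This is the condition
    at infinity in (P), and it makes soft thresholds finitely supported. *)
Lemma inE_vanishing u d : E u -> 0 < d ->
  exists k : nat, forall n, (Z.of_nat k <= Z.abs n)%Z -> Rabs (u n) <= d.
Proof.
  intros Hu Hd; assert (L := ex_series_lim_0 _ Hu).
  assert (e : 0 < b0 * rpow d p) by (apply Rmult_lt_0_compat; [exact Hb0 | apply rpow_gt0; lra]).
  destruct (proj2 (is_lim_seq_spec _ _) L (mkposreal _ e)) as [k Hk]; exists k.
  intros n Hn; specialize (Hk (Z.abs_nat n) ltac:(lia)); simpl in Hk; rewrite Rminus_0_r in Hk.
  apply Rnot_lt_le; intros Hlt.
  assert (T := zpair_ge_term (fun n => Rabs (normterm p a b u n)) n (fun m => Rabs_pos _)).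
  simpl in T; rewrite Rabs_pos_eq in T by apply normterm_ge0.
  apply Rabs_def2 in Hk.
  assert (X : rpow d p < rpow (Rabs (u n)) p) by (apply rpow_lt; lra).
  assert (Y : b n * rpow (Rabs (u n)) p <= normterm p a b u n).
  { unfold normterm; assert (0 <= a n * rpow (Rabs (Delta u n)) p); [|lra].
    apply Rmult_le_pos; [apply Rlt_le, Ha | apply rpow_ge0]. }
  generalize (Hb n) (rpow_ge0 d p); nra.
Qed.

(* Plain truncations of [v] need not converge in [E], since [a] may be unbounded; soft
   thresholding is a contraction, so it does not increase [|Delta v|], and since [v]
   vanishes at infinity it produces finite supports. *)
Lemma minimizer_critical : critical p q r a b c w.
Proof.
  split; [now apply inD_inE|]; intros v Hv%inD_inE.
  pose (d := fun k : nat => / (INR k + 1)).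
  assert (dpos : forall k, 0 < d k)
    by (intros k; apply Rinv_0_lt_compat; generalize (pos_INR k); lra).
  pose (vk := fun (k : nat) n => soft (d k) (v n)).
  assert (H1 : forall k n, Rabs (vk k n) <= Rabs (v n))
    by (intros k n; apply (soft_spec (d k) (v n) 0 (dpos k))).
  assert (H2 : forall k n, Rabs (Delta (vk k) n) <= Rabs (Delta v n))
    by (intros k n; apply (soft_spec (d k) (v (n + 1)%Z) (v n) (dpos k))).
  assert (Ek : forall k, E (vk k)).
  { intros k; apply (inE_dominated v _ 1 Hv); [lra | |]; intros n; rewrite Rmult_1_l; auto. }
  assert (Z0 : forall k, dI p q r a b c w (vk k) = 0).
  { intros k; destruct (inE_vanishing v (d k) Hv (dpos k)) as [K HK].
    apply (minimizer_finite_support K); [apply Ek|].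
    intros n Hn; now apply (soft_spec (d k) (v n) 0 (dpos k)), HK. }
  assert (Lv : forall n, is_lim_seq (fun k => vk k n) (v n)).
  { intros n; apply (is_lim_seq_le_le (fun k => v n - d k) _ (fun k => v n + d k)).
    - intros k; destruct (soft_spec (d k) (v n) 0 (dpos k)) as [_ [_ [X _]]].
      apply Rabs_le_between in X; unfold vk; lra.
    - apply is_lim_seq_inv_INR.
    - apply (is_lim_seq_ext (fun k => v n - (0 - d k))); [intros; ring|].
      replace (Finite (v n)) with (Finite (v n - 0)) by (f_equal; ring).
      apply is_lim_seq_minus'; [apply is_lim_seq_const | apply is_lim_seq_inv_INR]. }
  destruct (inE_bounded w Hw) as [M B]; destruct (inE_bounded v Hv) as [M1 B1].
  destruct (phi_ln_bounded M) as [K [_ HK]].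
  assert (L : is_lim_seq (fun k => dI p q r a b c w (vk k)) (dI p q r a b c w v)).
  { rewrite dI_eq; eapply is_lim_seq_ext; [intros k; symmetry; apply dI_eq|].
    apply is_lim_seq_minus'; [|apply (is_lim_seq_scal_l _ _ (Finite _))].
    - apply (zsum_dominated _ _ (fun n => normterm p a b w n + normterm p a b v n)).
      + intros k n; eapply Rle_trans; [apply Nterm_le|].
        apply Rplus_le_compat_l.
        assert (X := normterm_dominated v (vk k) 1 n Rle_0_1).
        rewrite !Rmult_1_l, rpow_1, Rmult_1_l in X; apply X; auto.
      + now apply zsummable_plus.
      + intros n; unfold Nterm, Delta.
        apply is_lim_seq_plus'; apply (is_lim_seq_scal_l _ _ (Finite _)),
          (is_lim_seq_scal_l _ _ (Finite _)); [|apply Lv].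
        apply is_lim_seq_minus'; apply Lv.
    - apply (zsum_dominated _ _ (fun n => c n * (K * M1))).
      + intros k n; rewrite Rabs_mult, (Rabs_pos_eq (c n)) by apply Rlt_le, Hc.
        apply Rmult_le_compat_l; [apply Rlt_le, Hc|]; rewrite Rabs_mult.
        apply Rmult_le_compat; try apply Rabs_pos; [apply HK, B|].
        eapply Rle_trans; [apply H1 | apply B1].
      + apply (zsummable_c_bounded _ (Rabs (K * M1))); intros; lra.
      + intros n; apply (is_lim_seq_scal_l _ _ (Finite _)),
          (is_lim_seq_scal_l _ _ (Finite _)), Lv. }
  apply (is_lim_seq_ext _ (fun _ => 0) _ Z0) in L.
  apply is_lim_seq_unique in L; rewrite Lim_seq_const in L; now injection L.
Qed.

End Minimizer.

(** * Sign changes of the minimizer *)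

Section SignChange.
Context (w z : Z -> R).
Context (HwM : inM p q r a b c w).
Context (Hmin : forall u, inM p q r a b c u -> I p q r a b c w <= I p q r a b c u).
Context (Hcrit : critical p q r a b c w).
Let v n := w n - z n.
Context (Hz : forall n, z n = w n \/ z n = 0).
Context (Hz1 : forall n, 0 <= Delta (posp v) n * Delta z n).
Context (Hz2 : forall n, 0 <= Delta (negp v) n * Delta z n).
Context (Hz0 : exists n, z n <> 0).
Context (Hv1 : exists n, 0 < v n).
Context (Hv2 : exists n, v n < 0).

Let Hw : E w.
Proof. apply inD_inE, HwM. Qed.

Let DvDz n : 0 <= Delta v n * Delta z n.
Proof. rewrite <- (Delta_parts v n); generalize (Hz1 n) (Hz2 n); lra. Qed.

Let v_cases n : v n = w n /\ z n = 0 \/ v n = 0 /\ z n = w n.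
Proof. unfold v; destruct (Hz n) as [-> | ->]; [right | left]; split; ring. Qed.

Let Abs_v n : Rabs (v n) <= Rabs (w n).
Proof.
  destruct (v_cases n) as [[-> _]|[-> _]]; [lra | rewrite Rabs_R0; apply Rabs_pos].
Qed.

Let Abs_Dv n : Rabs (Delta v n) <= Rabs (Delta w n).
Proof.
  replace (Delta w n) with (Delta v n + Delta z n) by (unfold v, Delta; ring).
  rewrite Rabs_plus_same_sign by apply DvDz; generalize (Rabs_pos (Delta z n)); lra.
Qed.

Let Ev : E v.
Proof.
  apply (inE_dominated w _ 1 Hw); [lra | |]; intros n; rewrite Rmult_1_l;
    [apply Abs_v | apply Abs_Dv].
Qed.

(** The derivative at [w] in the direction [x] is 0. Passing from [w] to [v] leaves the logarithmic
    pairing unchanged and, as the increments of [x], [y] and [z] share their sign, does not raise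
    the norm pairing. *)
Let dI_part_le (x y : Z -> R) :
  (forall n, x n + y n = v n) -> (forall n, x n = v n \/ x n = 0) -> E x ->
  (forall n, 0 <= Delta x n * Delta y n) ->
  (forall n, 0 <= Delta x n * Delta z n) -> (forall n, 0 <= Delta y n * Delta z n) ->
  dI p q r a b c v x <= 0.
Proof.
  intros Hxy Hx Ex Sxy Sxz Syz.
  apply Rle_trans with (dI p q r a b c w x); [|right; apply Hcrit; now apply inD_inE].
  assert (Hxw : forall n, x n = w n \/ x n = 0).
  { intros n; destruct (Hx n) as [-> | ->]; [|now right].
    destruct (v_cases n) as [[-> _]|[-> _]]; [now left | now right]. }
  rewrite !dI_eq, (Ld_restrict v x Hx), (Ld_restrict w x Hxw).
  assert (Nd v x <= Nd w x); [|lra].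
  apply zsum_le; [|now apply zsummable_Nterm | now apply zsummable_Nterm].
  intros n; unfold Nterm.
  assert (X1 : phi p (Delta v n) * Delta x n <= phi p (Delta w n) * Delta x n).
  { replace (Delta v n) with (Delta y n + Delta x n)
      by (unfold Delta; rewrite <- !Hxy; ring).
    replace (Delta w n) with (Delta y n + Delta x n + Delta z n).
    - apply phi_mono_same_sign; auto; rewrite Rmult_comm; apply Sxy.
    - unfold Delta; generalize (Hxy n) (Hxy (n + 1)%Z); unfold v; lra. }
  assert (X2 : phi p (v n) * x n = phi p (w n) * x n).
  { destruct (v_cases n) as [[-> _]|[V _]]; [reflexivity|].
    destruct (Hx n) as [-> | ->]; [rewrite V|]; ring. }
  rewrite X2; generalize (Ha n); nra.
Qed.

Lemma sign_component_contradiction : False.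
Proof.
  assert (D1 : dI p q r a b c v (posp v) <= 0).
  { apply (dI_part_le (posp v) (negp v)); auto.
    - apply posp_negp.
    - intros n; destruct (parts_cases v n) as [[_ [-> _]]|[_ [-> _]]]; auto.
    - now apply inE_posp.
    - apply Delta_parts_same_sign. }
  assert (D2 : dI p q r a b c v (negp v) <= 0).
  { apply (dI_part_le (negp v) (posp v)); auto.
    - intros n; rewrite Rplus_comm; apply posp_negp.
    - intros n; destruct (parts_cases v n) as [[_ [_ ->]]|[_ [_ ->]]]; auto.
    - now apply inE_negp.
    - intros n; rewrite Rmult_comm; apply Delta_parts_same_sign. }
  destruct (projection_inM v Ev Hv1 Hv2) as [s [t [Hs [Ht HM]]]].
  assert (L := Hmin _ HM).
  assert (F := I_fibering s t v ltac:(lra) ltac:(lra) Ev).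
  assert (Iv := I_minus_dI v Ev); assert (Iw := I_minus_dI w Hw).
  destruct HwM as [_ [_ [_ [W1 W2]]]]; rewrite W1, W2 in Iw.
  assert (LN : N v <= N w).
  { apply zsum_le; [|exact Ev | exact Hw]; intros n.
    assert (X := normterm_dominated w v 1 n Rle_0_1).
    rewrite !Rmult_1_l, rpow_1, Rmult_1_l in X; apply X; [apply Abs_v | apply Abs_Dv]. }
  (* The strict inequality arises here: at a site where [z] is nonzero the term of [w] is missing
     from [Sc v]. *)
  assert (LS : Sc v < Sc w).
  { destruct (inE_bounded w Hw) as [M B]; destruct (inE_bounded v Ev) as [M1 B1].
    apply Rminus_lt_0; unfold Sc; rewrite <- zsum_minus
      by ((now apply (zsummable_Sc v M1)) || now apply (zsummable_Sc w M)).
    apply zsum_gt0.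
    - intros n; assert (rpow (Rabs (v n)) q <= rpow (Rabs (w n)) q)
        by (apply rpow_le; [lra | split; [apply Rabs_pos | apply Abs_v]]).
      generalize (Hc n); nra.
    - destruct Hz0 as [n Hn]; exists n.
      destruct (v_cases n) as [[_ V]|[-> V]]; [contradiction|].
      rewrite Rabs_R0, rpow_0, Rmult_0_r, Rminus_0_r.
      apply Rmult_lt_0_compat; [apply Hc | apply rpow_gt0, Rabs_no_R0; now rewrite <- V].
    - apply zsummable_minus; [now apply (zsummable_Sc w M) | now apply (zsummable_Sc v M1)]. }
  assert (C1 := Sc_ge0 _ (inE_posp v Ev)); assert (C2 := Sc_ge0 _ (inE_negp v Ev)).
  assert (0 <= r / q ^ 2 * (Sc (posp v) * (1 - rpow s q + rpow s q * ln (rpow s q))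
                 + Sc (negp v) * (1 - rpow t q + rpow t q * ln (rpow t q)))).
  { apply Rmult_le_pos; [apply Rlt_le, rq|].
    apply Rplus_le_le_0_compat; apply Rmult_le_pos; try assumption; apply h0, rpow_ge0. }
  (* Since both derivatives are nonpositive, (1 - s^q)/q may be replaced by 1/q, whatever the
     projection parameters are. *)
  assert (G : forall x d, d <= 0 -> 1 / q * d <= (1 - rpow x q) / q * d).
  { intros x d Hd; assert (0 < / q) by (apply Rinv_0_lt_compat; lra).
    unfold Rdiv; rewrite !Rmult_assoc, (Rmult_comm (/ q)).
    generalize (rpow_ge0 x q); intros; assert (d * / q <= 0) by nra; nra. }
  generalize (G s _ D1) (G t _ D2).
  assert ((1 / p - 1 / q) * N v <= (1 / p - 1 / q) * N w)
    by (apply Rmult_le_compat_l; [apply Rlt_le, inv_pq | exact LN]).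
  assert (r / q ^ 2 * Sc v < r / q ^ 2 * Sc w) by (apply Rmult_lt_compat_l; [apply rq | exact LS]).
  lra.
Qed.
End SignChange.

Section SignPattern.
Context (w : Z -> R).
Context (HwM : inM p q r a b c w).
Context (Hmin : forall u, inM p q r a b c u -> I p q r a b c w <= I p q r a b c u).
Context (Hcrit : critical p q r a b c w).

(** The deleted [z] is all of w^+ beyond j. As w^+ vanishes at j, the increments of [z] live on n >=
    j and those of v^+ on n < j, while v^- = w^-. The entries at i and j keep both signs in [v]. *)
Lemma no_pos_neg_pos i j k : (i < j)%Z -> (j < k)%Z -> 0 < w i -> w j < 0 -> 0 < w k -> False.
Proof.
  intros Hij Hjk Hi Hj Hk.
  set (z := fun n => if Z_lt_dec j n then posp w n else 0).
  set (v := fun n => w n - z n).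
  assert (vP : forall n, posp v n = if Z_lt_dec j n then 0 else posp w n).
  { intros n; unfold v, z; unfold posp at 1; destruct (Z_lt_dec j n).
    - rewrite Rmax_right; [reflexivity|].
      destruct (parts_cases w n) as [[? [-> _]]|[? [-> _]]]; lra.
    - now rewrite Rminus_0_r. }
  assert (vN : forall n, negp v n = negp w n).
  { intros n; unfold v, z; unfold negp at 1; destruct (Z_lt_dec j n).
    - destruct (parts_cases w n) as [[? [-> ->]]|[? [-> ->]]]; rewrite Rmin_left; lra.
    - now rewrite Rminus_0_r. }
  assert (Pj : posp w j = 0) by (destruct (parts_cases w j) as [|[_ [-> _]]]; lra).
  (* The increment at n joins n and n + 1, so the cut [j < n] becomes [j <= n] for increments; [Pj]
     settles n = j. *)
  assert (Dz : forall n, Delta z n = if Z_lt_dec n j then 0 else Delta (posp w) n).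
  { intros n; unfold Delta, z.
    destruct (Z_lt_dec j (n + 1)), (Z_lt_dec j n), (Z_lt_dec n j); try lia; try ring.
    replace n with j by lia; rewrite Pj; ring. }
  assert (DP : forall n, Delta (posp v) n = if Z_lt_dec n j then Delta (posp w) n else 0).
  { intros n; unfold Delta; rewrite !vP.
    destruct (Z_lt_dec j (n + 1)), (Z_lt_dec j n), (Z_lt_dec n j); try lia; try ring.
    replace n with j by lia; rewrite Pj; ring. }
  apply (sign_component_contradiction w z HwM Hmin Hcrit); fold v.
  - intros n; unfold z; destruct (Z_lt_dec j n); [|now right].
    destruct (parts_cases w n) as [[_ [-> _]]|[_ [-> _]]]; auto.
  - intros n; rewrite Dz, DP; destruct (Z_lt_dec n j); lra.
  - intros n; rewrite Dz; destruct (Z_lt_dec n j); [lra|].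
    replace (Delta (negp v) n) with (Delta (negp w) n) by (unfold Delta; now rewrite !vN).
    rewrite Rmult_comm; apply Delta_parts_same_sign.
  - exists k; unfold z; destruct (Z_lt_dec j k); [|lia].
    destruct (parts_cases w k) as [[_ [-> _]]|]; lra.
  - exists i; unfold v, z; destruct (Z_lt_dec j i); [lia | lra].
  - exists j; unfold v, z; destruct (Z_lt_dec j j); [lia | lra].
Qed.

(** Mirror image: w^- beyond j is deleted, and v^+ = w^+. *)
Lemma no_neg_pos_neg i j k : (i < j)%Z -> (j < k)%Z -> w i < 0 -> 0 < w j -> w k < 0 -> False.
Proof.
  intros Hij Hjk Hi Hj Hk.
  set (z := fun n => if Z_lt_dec j n then negp w n else 0).
  set (v := fun n => w n - z n).
  assert (vN : forall n, negp v n = if Z_lt_dec j n then 0 else negp w n).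
  { intros n; unfold v, z; unfold negp at 1; destruct (Z_lt_dec j n).
    - rewrite Rmin_right; [reflexivity|].
      destruct (parts_cases w n) as [[? [_ ->]]|[? [_ ->]]]; lra.
    - now rewrite Rminus_0_r. }
  assert (vP : forall n, posp v n = posp w n).
  { intros n; unfold v, z; unfold posp at 1; destruct (Z_lt_dec j n).
    - destruct (parts_cases w n) as [[? [-> ->]]|[? [-> ->]]];
        [rewrite Rmax_left | rewrite Rmax_right]; lra.
    - now rewrite Rminus_0_r. }
  assert (Nj : negp w j = 0) by (destruct (parts_cases w j) as [[_ [_ ->]]|]; lra).
  assert (Dz : forall n, Delta z n = if Z_lt_dec n j then 0 else Delta (negp w) n).
  { intros n; unfold Delta, z.
    destruct (Z_lt_dec j (n + 1)), (Z_lt_dec j n), (Z_lt_dec n j); try lia; try ring.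
    replace n with j by lia; rewrite Nj; ring. }
  assert (DN : forall n, Delta (negp v) n = if Z_lt_dec n j then Delta (negp w) n else 0).
  { intros n; unfold Delta; rewrite !vN.
    destruct (Z_lt_dec j (n + 1)), (Z_lt_dec j n), (Z_lt_dec n j); try lia; try ring.
    replace n with j by lia; rewrite Nj; ring. }
  apply (sign_component_contradiction w z HwM Hmin Hcrit); fold v.
  - intros n; unfold z; destruct (Z_lt_dec j n); [|now right].
    destruct (parts_cases w n) as [[_ [_ ->]]|[_ [_ ->]]]; auto.
  - intros n; rewrite Dz; destruct (Z_lt_dec n j); [lra|].
    replace (Delta (posp v) n) with (Delta (posp w) n) by (unfold Delta; now rewrite !vP).
    apply Delta_parts_same_sign.
  - intros n; rewrite Dz, DN; destruct (Z_lt_dec n j); lra.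
  - exists k; unfold z; destruct (Z_lt_dec j k); [|lia].
    destruct (parts_cases w k) as [|[_ [_ ->]]]; lra.
  - exists j; unfold v, z; destruct (Z_lt_dec j j); [lia | lra].
  - exists i; unfold v, z; destruct (Z_lt_dec j i); [lia | lra].
Qed.
End SignPattern.

End Variational.

(** * From excluded sign patterns to a single cut *)

Lemma last_before (P : Z -> Prop) i j : (i < j)%Z -> P i -> ~ P j ->
  exists k, (i <= k < j)%Z /\ P k /\ forall n, (k < n <= j)%Z -> ~ P n.
Proof.
  intros Hij Pi Pj.
  assert (H : forall d : nat, (Z.of_nat d <= j - i)%Z ->
    (forall n, (j - Z.of_nat d <= n <= j)%Z -> ~ P n) \/
    exists k, (i <= k < j)%Z /\ P k /\ forall n, (k < n <= j)%Z -> ~ P n).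
  { induction d as [|d IH]; intros Hd.
    - left; intros n Hn; now replace n with j by lia.
    - destruct IH as [H|H]; [lia | | now right].
      destruct (classic (P (j - Z.of_nat (S d))%Z)) as [Q|Q].
      + right; exists (j - Z.of_nat (S d))%Z; split; [lia|]; split; [exact Q|].
        intros n Hn; apply H; lia.
      + left; intros n Hn; destruct (Z.eq_dec n (j - Z.of_nat (S d))) as [->|Hne]; [exact Q|].
        apply H; lia. }
  destruct (H (Z.to_nat (j - i)) ltac:(lia)) as [X|X]; [|exact X].
  exfalso; apply (X i); [lia | exact Pi].
Qed.

(** If i < j, the cut is the last positive index before j: a negative entry to its left would give -
    + -, a positive entry beyond j would give + - +. The other order is symmetric. *)
Lemma changes_sign_once_of_patterns u : (exists n, 0 < u n) -> (exists n, u n < 0) ->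
  (forall i j k, (i < j)%Z -> (j < k)%Z -> 0 < u i -> u j < 0 -> 0 < u k -> False) ->
  (forall i j k, (i < j)%Z -> (j < k)%Z -> u i < 0 -> 0 < u j -> u k < 0 -> False) ->
  changes_sign_once u.
Proof.
  intros [i Hi] [j Hj] PNP NPN; split; [now exists i|]; split; [now exists j|].
  destruct (Z_lt_ge_dec i j) as [Hij|Hij].
  - destruct (last_before (fun n => 0 < u n) i j Hij Hi ltac:(lra)) as [k [Hk [Pk Hl]]].
    exists k; left; split; intros n Hn; apply Rnot_lt_le; intros Hun.
    + destruct (Z.eq_dec n k); [subst; lra|].
      apply (NPN n k j); try assumption; lia.
    + destruct (Z_le_gt_dec n j); [now apply (Hl n)|].
      apply (PNP k j n); try assumption; lia.
  - assert (Hji : (j < i)%Z) by (destruct (Z.eq_dec i j); [subst; lra | lia]).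
    destruct (last_before (fun n => u n < 0) j i Hji Hj ltac:(lra)) as [k [Hk [Pk Hl]]].
    exists k; right; split; intros n Hn; apply Rnot_lt_le; intros Hun.
    + destruct (Z.eq_dec n k); [subst; lra|].
      apply (PNP n k i); try assumption; lia.
    + destruct (Z_le_gt_dec n i); [now apply (Hl n)|].
      apply (NPN k i n); try assumption; lia.
Qed.

Theorem theorem1p1 (p q r : R) (a b c : Z -> R)
  (Hp : 1 < p) (Hpq : p < q) (Hp2 : exists k : nat, (1 <= k)%nat /\ p / 2 = INR k)
  (Hr : 1 <= r)
  (Ha : forall n, 0 < a n) (Hb : forall n, 0 < b n) (Hc : forall n, 0 < c n)
  (C1 : (exists b0, 0 < b0 /\ forall n, b0 <= b n) /\
        (forall M, exists N : Z, forall n, (N < Z.abs n)%Z -> M < b n))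
  (C2 : (exists c0, 0 < c0 /\ forall n, c n <= c0) /\ zsummable c) :
  exists u0 : Z -> R,
    inM p q r a b c u0 /\ critical p q r a b c u0 /\
    (forall u, inM p q r a b c u -> I p q r a b c u0 <= I p q r a b c u) /\
    0 < I p q r a b c u0 /\
    changes_sign_once u0.
Proof.
  destruct C1 as [[b0 [Hb0 Hbb]] _]; destruct C2 as [_ Hcs].
  assert (Hr0 : 0 < r) by lra.
  destruct (minimizer_exists p q r a b c b0) as [w [HM Hmin]]; try assumption.
  assert (Hcrit : critical p q r a b c w)
    by (now apply (minimizer_critical p q r a b c b0)).
  exists w; split; [exact HM|]; split; [exact Hcrit|]; split; [exact Hmin|]; split.
  - apply Rle_lt_trans with ((1 / p - 1 / q) * normp p a b w).
    + apply Rmult_le_pos; [left; now apply inv_pq|].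
      apply (N_ge0 p a b b0); try assumption; apply HM.
    + now apply (I_M_lower p q r a b c b0).
  - destruct HM as [HD [P1 [P2 P3]]].
    apply changes_sign_once_of_patterns; [now apply posp_neq0 | now apply negp_neq0 | |].
    + now apply (no_pos_neg_pos p q r a b c b0).
    + now apply (no_neg_pos_neg p q r a b c b0).
Qed.
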